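(* Let $P$ be a collection of $n$ points in the plane lying on a set $L$ of $n$ lines (i.e. each point of $P$ lies on at least one line of $L$), where no line of $L$ is vertical. The largest subset of isolated points of $P$ can be computed in $O(n^3)$ time.
   Context: The lines of $L$ are not necessarily in general position. A point $p\in P$ can reach a point $q\in P$ if it is possible to get from $p$ to $q$ by traveling from left to right (in the direction of increasing $x$-coordinate) along lines of $L$, where one may switch from one line to another at a point where they intersect. A subset of $P$ is isolated if no point in it can reach another point in it (using the lines of $L$). ''Largest'' means of maximum cardinality. *)

(* Defs.v *)
From HB Require Import structures.
From mathcomp Require Import all_boot all_order all_algebra.
From mathcomp Require Import reals.

Set Implicit Arguments.
Unset Strict Implicit.
Unset Printing Implicit Defensive.

Import Order.TTheory GRing.Theory Num.Theory.
Local Open Scope ring_scope.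

Section Geometry.
Variable R : realType.

Definition point : Type := R * R.

(* (a, b, c) stands for the line a x + b y = c, provided (a, b) <> (0, 0);
   coefficient triples are unique only up to scaling. *)
Definition line : Type := R * R * R.

Definition nondegenerate (l : line) : bool := (l.1.1 != 0) || (l.1.2 != 0).

Definition vertical (l : line) : bool := l.1.2 == 0.

Definition on_line (l : line) (p : point) : bool :=
  l.1.1 * p.1 + l.1.2 * p.2 == l.2.

Definition step (L : seq line) (u v : point) : bool :=
  (u.1 < v.1) && has (fun l => on_line l u && on_line l v) L.

(* The vertices of the path where the traveller changes line lie on both the
   old and the new line, that is, at an intersection of the two. *)
Definition reach (L : seq line) (p q : point) : Prop :=
  exists2 s : seq point, path (step L) p s & last p s = q.

Variable n : nat.

Record point_line_config (P : n.-tuple point) (L : n.-tuple line) : Prop := {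
  points_distinct : forall i j : 'I_n, tnth P i = tnth P j -> i = j;
  lines_nondegenerate : forall j : 'I_n, nondegenerate (tnth L j);
  (* distinct as sets of points, not merely as coefficient triples *)
  lines_distinct : forall i j : 'I_n,
    on_line (tnth L i) =1 on_line (tnth L j) -> i = j;
  lines_nonvertical : forall j : 'I_n, ~~ vertical (tnth L j);
  points_on_lines : forall i : 'I_n,
    exists j : 'I_n, on_line (tnth L j) (tnth P i)
}.

(* Subsets of P are represented by sets of indices into P. *)
Definition isolated (P : n.-tuple point) (L : n.-tuple line)
    (A : {set 'I_n}) : Prop :=
  forall i j : 'I_n, i \in A -> j \in A -> i != j ->
    ~ reach L (tnth P i) (tnth P j).

Definition largest_isolated (P : n.-tuple point) (L : n.-tuple line)
    (A : {set 'I_n}) : Prop :=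
  isolated P L A /\
  forall B : {set 'I_n}, isolated P L B -> (#|B| <= #|A|)%N.

End Geometry.

(* A real RAM with structured control flow.  Memory consists of two-dimensional
   arrays, of natural numbers and of reals; an array name is part of the
   program text, the two indices are computed.

   Natural numbers are only compared, incremented and decremented, so that
   words have O(log (n + t)) bits after t operations and unit cost is
   legitimate.  Reals support field operations and comparison only: there is
   no rounding, no conversion to natural numbers, and the only real constants
   are 0 and 1, so that no information can be hidden in a program. *)

Inductive nexp : Type :=
| NConst of nat
| NGet of nat & nexp & nexp
| NSucc of nexp
| NPred of nexp.

Inductive rexp : Type :=
| RZero
| ROne
| RGet of nat & nexp & nexp
| RAdd of rexp & rexp
| RSub of rexp & rexp
| RMul of rexp & rexp
| RDiv of rexp & rexp.

Inductive bexp : Type :=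
| BLeN of nexp & nexp
| BLeR of rexp & rexp
| BNot of bexp
| BAnd of bexp & bexp.

Inductive prog : Type :=
| Skip
| SetN of nat & nexp & nexp & nexp
| SetR of nat & nexp & nexp & rexp
| Seq of prog & prog
| If of bexp & prog & prog
| While of bexp & prog.

Definition memory (T : Type) : Type := nat -> nat -> nat -> T.

Definition upd (T : Type) (m : memory T) (a i j : nat) (v : T) : memory T :=
  fun a' i' j' => if [&& a' == a, i' == i & j' == j] then v else m a' i' j'.

(* The time taken by an expression is its number of nodes. *)
Fixpoint ntime (e : nexp) : nat :=
  (match e with
  | NConst _ => 1
  | NGet _ e1 e2 => (ntime e1 + ntime e2).+1
  | NSucc e1 | NPred e1 => (ntime e1).+1
  end)%N.

Fixpoint rtime (e : rexp) : nat :=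
  (match e with
  | RZero | ROne => 1
  | RGet _ e1 e2 => (ntime e1 + ntime e2).+1
  | RAdd e1 e2 | RSub e1 e2 | RMul e1 e2 | RDiv e1 e2 =>
      (rtime e1 + rtime e2).+1
  end)%N.

Fixpoint btime (b : bexp) : nat :=
  (match b with
  | BLeN e1 e2 => (ntime e1 + ntime e2).+1
  | BLeR e1 e2 => (rtime e1 + rtime e2).+1
  | BNot b1 => (btime b1).+1
  | BAnd b1 b2 => (btime b1 + btime b2).+1
  end)%N.

Section Semantics.
Variable R : realType.

Record state : Type := State { nmem : memory nat; rmem : memory R }.

Fixpoint neval (s : state) (e : nexp) : nat :=
  match e with
  | NConst k => k
  | NGet a e1 e2 => nmem s a (neval s e1) (neval s e2)
  | NSucc e1 => (neval s e1).+1
  | NPred e1 => (neval s e1).-1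
  end.

Fixpoint reval (s : state) (e : rexp) : R :=
  match e with
  | RZero => 0
  | ROne => 1
  | RGet a e1 e2 => rmem s a (neval s e1) (neval s e2)
  | RAdd e1 e2 => reval s e1 + reval s e2
  | RSub e1 e2 => reval s e1 - reval s e2
  | RMul e1 e2 => reval s e1 * reval s e2
  | RDiv e1 e2 => reval s e1 / reval s e2
  end.

Fixpoint beval (s : state) (b : bexp) : bool :=
  match b with
  | BLeN e1 e2 => (neval s e1 <= neval s e2)%N
  | BLeR e1 e2 => reval s e1 <= reval s e2
  | BNot b1 => ~~ beval s b1
  | BAnd b1 b2 => beval s b1 && beval s b2
  end.

(* exec c s s' t: started in s, program c halts in s' after time t. *)
Inductive exec : prog -> state -> state -> nat -> Prop :=
| ExecSkip s : exec Skip s s 1%N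
| ExecSetN s a e1 e2 e :
    exec (SetN a e1 e2 e) s
      (State (upd (nmem s) a (neval s e1) (neval s e2) (neval s e)) (rmem s))
      (ntime e1 + ntime e2 + ntime e).+1%N
| ExecSetR s a e1 e2 e :
    exec (SetR a e1 e2 e) s
      (State (nmem s) (upd (rmem s) a (neval s e1) (neval s e2) (reval s e)))
      (ntime e1 + ntime e2 + rtime e).+1%N
| ExecSeq c1 c2 s1 s2 s3 t1 t2 :
    exec c1 s1 s2 t1 -> exec c2 s2 s3 t2 ->
    exec (Seq c1 c2) s1 s3 (t1 + t2).+1%N
| ExecIfTrue b c1 c2 s s' t :
    beval s b -> exec c1 s s' t -> exec (If b c1 c2) s s' (btime b + t).+1%N
| ExecIfFalse b c1 c2 s s' t :
    ~~ beval s b -> exec c2 s s' t -> exec (If b c1 c2) s s' (btime b + t).+1%N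
| ExecWhileFalse b c s :
    ~~ beval s b -> exec (While b c) s s (btime b).+1%N
| ExecWhileTrue b c s1 s2 s3 t1 t2 :
    beval s1 b -> exec c s1 s2 t1 -> exec (While b c) s2 s3 t2 ->
    exec (While b c) s1 s3 (btime b + t1 + t2).+1%N.

(* Input: n in cell (0, 0) of natural array 0, the coordinates of the i-th
   point in row i of real array 0, and the coefficients of the j-th line in
   row j of real array 1; all other cells hold 0. *)
Definition input (n : nat) (P : n.-tuple (point R)) (L : n.-tuple (line R)) :
    state :=
  State
    (fun a i j => match a, i, j with 0, 0, 0 => n | _, _, _ => 0 end%N)
    (fun a i j =>
       match a, j with
       | 0%N, 0%N => (nth (0, 0) P i).1
       | 0%N, 1%N => (nth (0, 0) P i).2
       | 1%N, 0%N => (nth (0, 0, 0) L i).1.1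
       | 1%N, 1%N => (nth (0, 0, 0) L i).1.2
       | 1%N, 2%N => (nth (0, 0, 0) L i).2
       | _, _ => 0
       end).

(* Output: the characteristic vector in column 0 of natural array 1. *)
Definition output (n : nat) (s : state) : {set 'I_n} :=
  [set i : 'I_n | nmem s 1%N i 0%N == 1%N].

End Semantics.

(* Main.v *)
Require Import Defs.
From mathcomp Require Import all_boot all_order all_algebra.
From mathcomp Require Import reals.
From mathcomp Require Import zify ring.

(* Reachability.  For each source point, Dijkstra's algorithm runs on the lines
   instead of on the arrangement: the distance of a line is the leftmost
   abscissa at which it can be entered, and a settled line relaxes all those
   that it crosses further right.  This takes O(n^2) per source.

   Antichain.  Reachability is a strict order on the points, and an isolated set
   is an antichain, so by Dilworth and Koenig it suffices to match the points
   to their successors optimally.  The matching is found by an auction: an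
   active point takes its cheapest successor, evicting the previous owner and
   raising the price by one, and retires when the cheapest price exceeds n.
   There are O(n^2) bids of cost O(n).  By pigeonhole some price k + 1 with
   k <= n is not attained, and it separates the matched pairs into a vertex
   cover whose size is that of the matching; the points neither copy of which
   is in the cover form a largest antichain. *)

Set Implicit Arguments.
Unset Strict Implicit.
Unset Printing Implicit Defensive.

Import Order.TTheory GRing.Theory Num.Theory.

(** * Programs with bounded loops *)

(* [CFor i c] runs [c] for i = 0, ..., n - 1, where n is the cell (0, 0) of
   array 0, so that the exponent of the running time is the nesting depth. *)
Inductive cmd : Type :=
| CSkip
| CSetN of nat & nexp & nexp & nexp
| CSetR of nat & nexp & nexp & rexp
| CSeq of cmd & cmd
| CIf of bexp & cmd & cmd
| CFor of nat & cmd.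

Definition var (a : nat) : nexp := NGet a (NConst 0) (NConst 0).
Definition cell (a : nat) (e : nexp) : nexp := NGet a e (NConst 0).
Definition set_var (a : nat) (e : nexp) : cmd :=
  CSetN a (NConst 0) (NConst 0) e.
Definition set_cell (a : nat) (e1 e : nexp) : cmd := CSetN a e1 (NConst 0) e.

Fixpoint compile (c : cmd) : prog :=
  match c with
  | CSkip => Skip
  | CSetN a e1 e2 e => SetN a e1 e2 e
  | CSetR a e1 e2 e => SetR a e1 e2 e
  | CSeq c1 c2 => Seq (compile c1) (compile c2)
  | CIf b c1 c2 => If b (compile c1) (compile c2)
  | CFor i c1 =>
      Seq (SetN i (NConst 0) (NConst 0) (NConst 0))
        (While (BNot (BLeN (var 0) (var i)))
          (Seq (compile c1)
            (SetN i (NConst 0) (NConst 0) (NSucc (var i)))))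
  end.

Fixpoint nat_writes (c : cmd) : seq nat :=
  match c with
  | CSetN a _ _ _ => [:: a]
  | CSeq c1 c2 | CIf _ c1 c2 => nat_writes c1 ++ nat_writes c2
  | CFor i c1 => i :: nat_writes c1
  | _ => [::]
  end.

Fixpoint real_writes (c : cmd) : seq nat :=
  match c with
  | CSetR a _ _ _ => [:: a]
  | CSeq c1 c2 | CIf _ c1 c2 => real_writes c1 ++ real_writes c2
  | CFor _ c1 => real_writes c1
  | _ => [::]
  end.

(** Together with an unmodified size cell, a body that leaves its counter alone makes the loop run
    exactly n times. *)
Fixpoint well_formed (c : cmd) : bool :=
  match c with
  | CSeq c1 c2 | CIf _ c1 c2 => well_formed c1 && well_formed c2
  | CFor i c1 =>
      (i \notin nat_writes c1) && well_formed c1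
  | _ => true
  end.

Fixpoint depth (c : cmd) : nat :=
  match c with
  | CSeq c1 c2 | CIf _ c1 c2 => maxn (depth c1) (depth c2)
  | CFor _ c1 => (depth c1).+1
  | _ => 0
  end.

(** Coefficient of n ^ [depth c] in the time bound. In a loop, 31 = 5 + 9 + 17 pays for the entry,
    the final failing test and the overhead of each round. *)
Fixpoint cost (c : cmd) : nat :=
  match c with
  | CSkip => 1
  | CSetN _ e1 e2 e => (ntime e1 + ntime e2 + ntime e).+1
  | CSetR _ e1 e2 e => (ntime e1 + ntime e2 + rtime e).+1
  | CSeq c1 c2 => (cost c1 + cost c2).+1
  | CIf b c1 c2 => (btime b + (cost c1 + cost c2)).+1
  | CFor _ c1 => cost c1 + 31
  end.

(** * Denotational semantics and running time *)

Section Denotation.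
Variable R : realType.
Implicit Types (c : cmd) (s : state R).

Definition put_var (a : nat) (v : nat) (s : state R) : state R :=
  State (upd (nmem s) a 0 0 v) (rmem s).

Definition tick (i : nat) (s : state R) : state R :=
  put_var i (nmem s i 0 0).+1 s.

Fixpoint den (c : cmd) (s : state R) : state R :=
  match c with
  | CSkip => s
  | CSetN a e1 e2 e =>
      State (upd (nmem s) a (neval s e1) (neval s e2) (neval s e)) (rmem s)
  | CSetR a e1 e2 e =>
      State (nmem s) (upd (rmem s) a (neval s e1) (neval s e2) (reval s e))
  | CSeq c1 c2 => den c2 (den c1 s)
  | CIf b c1 c2 => if beval s b then den c1 s else den c2 s
  | CFor i c1 =>
      iter (nmem s 0 0 0) (fun s' => tick i (den c1 s')) (put_var i 0 s)
  end.

Lemma upd_other (T : Type) (m : memory T) a i j v a' i' j' :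
  a' != a -> upd m a i j v a' i' j' = m a' i' j'.
Proof. by rewrite /upd => /negbTE->. Qed.

Lemma den_nmem c s a : a \notin nat_writes c ->
  forall i j, nmem (den c s) a i j = nmem s a i j.
Proof.
elim: c s => //= [b e1 e2 e|c1 IH1 c2 IH2|b c1 IH1 c2 IH2|k c1 IH1] s.
- by rewrite inE => ab i j; rewrite upd_other.
- by rewrite mem_cat negb_or => /andP[w1 w2] i j; rewrite IH2 ?IH1.
- by rewrite mem_cat negb_or => /andP[w1 w2] i j; case: ifP; rewrite ?IH2 ?IH1.
- rewrite inE negb_or => /andP[ak w1] i j.
  elim: (nmem s 0 0 0) => [|m IHm]; first by rewrite /= upd_other.
  by rewrite iterS /= upd_other // IH1.
Qed.

Lemma den_rmem c s a : a \notin real_writes c ->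
  forall i j, rmem (den c s) a i j = rmem s a i j.
Proof.
elim: c s => //= [b e1 e2 e|c1 IH1 c2 IH2|b c1 IH1 c2 IH2|k c1 IH1] s.
- by rewrite inE => ab i j; rewrite upd_other.
- by rewrite mem_cat negb_or => /andP[w1 w2] i j; rewrite IH2 ?IH1.
- by rewrite mem_cat negb_or => /andP[w1 w2] i j; case: ifP; rewrite ?IH2 ?IH1.
- by move=> w1 i j; elim: (nmem s 0 0 0) => [//|m IHm]; rewrite iterS /= IH1.
Qed.

(** Induction on the command. The bound asks for 0 < n, as a positive power of n vanishes at n = 0
    while the overhead of a loop does not. *)
Lemma compile_exec n c s : well_formed c -> 0 \notin nat_writes c ->
  nmem s 0 0 0 = n ->
  exists2 t, exec (compile c) s (den c s) t
           & 0 < n -> t <= cost c * n ^ depth c.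
Proof.
have weaken K d d' x : 0 < n -> x <= K * n ^ d -> d <= d' -> x <= K * n ^ d'.
  move=> n0 xK dd; apply: leq_trans xK _.
  by rewrite leq_mul2l leq_pexp2l // orbT.
have pow_gt0 d : 0 < n -> 0 < n ^ d by rewrite expn_gt0 => ->.
elim: c s => /=
    [|a e1 e2 e|a e1 e2 e|c1 IH1 c2 IH2|b c1 IH1 c2 IH2|k c1 IH1] s.
- by exists 1; [constructor | rewrite muln1].
- by eexists; [constructor | rewrite muln1].
- by eexists; [constructor | rewrite muln1].
- move=> /andP[w1 w2]; rewrite mem_cat negb_or => /andP[z1 z2] sn.
  have [t1 e1 b1] := IH1 s w1 z1 sn.
  have sn1 : nmem (den c1 s) 0 0 0 = n by rewrite den_nmem.
  have [t2 e2 b2] := IH2 (den c1 s) w2 z2 sn1.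
  exists (t1 + t2).+1; first exact: ExecSeq e1 e2.
  move=> n0.
  have := weaken _ _ _ _ n0 (b1 n0) (leq_maxl _ (depth c2)).
  have := weaken _ _ _ _ n0 (b2 n0) (leq_maxr (depth c1) _).
  have := pow_gt0 (maxn (depth c1) (depth c2)) n0.
  move: (_ ^ _) => p; nia.
- move=> /andP[w1 w2]; rewrite mem_cat negb_or => /andP[z1 z2] sn.
  have [t1 e1 b1] := IH1 s w1 z1 sn.
  have [t2 e2 b2] := IH2 s w2 z2 sn.
  have [sb|sb] := boolP (beval s b).
    exists (btime b + t1).+1; first exact: ExecIfTrue.
    move=> n0.
    have := weaken _ _ _ _ n0 (b1 n0) (leq_maxl _ (depth c2)).
    have := pow_gt0 (maxn (depth c1) (depth c2)) n0.
    move: (_ ^ _) => p; nia.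
  exists (btime b + t2).+1; first exact: ExecIfFalse.
  move=> n0.
  have := weaken _ _ _ _ n0 (b2 n0) (leq_maxr (depth c1) _).
  have := pow_gt0 (maxn (depth c1) (depth c2)) n0.
  move: (_ ^ _) => p; nia.
- move=> /andP[k1 w1]; rewrite inE negb_or => /andP[zk z1] sn.
  rewrite sn; set f := fun s' => tick k (den c1 s').
  set w := While _ _.
  (* Induction on the number m of rounds still to run; 9 is the time of the failing test, 17 the
     overhead of one round. *)
  have loop m s1 : nmem s1 0 0 0 = n -> nmem s1 k 0 0 + m = n ->
      exists2 t, exec w s1 (iter m f s1) t
               & 0 < n -> t <= 9 + m * (cost c1 * n ^ depth c1 + 17).
    elim: m s1 => [|m IHm] s1 s1n s1k.
      exists 9 => //; apply: ExecWhileFalse => /=.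
      by rewrite s1n negbK -s1k addn0.
    have [t1 e1 b1] := IH1 s1 w1 z1 s1n.
    have fn : nmem (f s1) 0 0 0 = n by rewrite /f /= upd_other // den_nmem.
    have fk : nmem (f s1) k 0 0 + m = n.
      by rewrite /f /= /upd !eqxx /= den_nmem // -s1k addSnnS.
    have [t2 e2 b2] := IHm (f s1) fn fk.
    exists (8 + (t1 + 7).+1 + t2).+1; last first.
      move=> n0; move: (b1 n0) (b2 n0); rewrite mulSn.
      move: (cost c1 * _) (m * _) => x y; lia.
    rewrite iterSr.
    apply: (ExecWhileTrue (b := BNot _) _ _ e2).
      by rewrite /= s1n -s1k; lia.
    by apply: (ExecSeq e1); apply: ExecSetN.
  have [|//|t et bt] := loop n (put_var k 0 s).
  + by rewrite /= upd_other.
  + by rewrite /= /upd !eqxx.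
  exists (4 + t).+1; first by apply: ExecSeq et; apply: ExecSetN.
  move=> n0; have := bt n0; have := pow_gt0 (depth c1) n0; rewrite expnS.
  move: (_ ^ _) => p; rewrite !(mulnDl, mulnDr) mulnCA; nia.
Qed.
End Denotation.

(** * Proof rules for loops and minimum search *)

Section Rules.
Variable R : realType.
Implicit Types (c : cmd) (s : state R).

Definition frame (ws wr : seq nat) (s s' : state R) : Prop :=
  (forall a, a \notin ws -> forall i j, nmem s' a i j = nmem s a i j) /\
  (forall a, a \notin wr -> forall i j, rmem s' a i j = rmem s a i j).

Lemma den_frame c s : frame (nat_writes c) (real_writes c) s (den c s).
Proof. by split=> a aw i j; rewrite ?den_nmem ?den_rmem. Qed.

Lemma frame_trans ws wr s1 s2 s3 :
  frame ws wr s1 s2 -> frame ws wr s2 s3 -> frame ws wr s1 s3.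
Proof.
by move=> [n12 r12] [n23 r23]; split=> a aw i j; rewrite ?n23 ?n12 ?r23 ?r12.
Qed.

Lemma frame_sub ws wr ws' wr' s s' : {subset ws <= ws'} -> {subset wr <= wr'} ->
  frame ws wr s s' -> frame ws' wr' s s'.
Proof.
move=> ss rs [ns' rs']; split=> a aw i j; [apply: ns' | apply: rs'].
  by apply: contra aw; apply: ss.
by apply: contra aw; apply: rs.
Qed.

(** Hoare rule for loops. The step receives the frame between the current state and the one before
    the loop, so invariants need not repeat that unwritten arrays are intact. *)
Lemma den_for (I : nat -> state R -> Prop) i c s n :
  well_formed (CFor i c) -> 0 \notin nat_writes (CFor i c) ->
  nmem s 0 0 0 = n -> I 0 (put_var i 0 s) ->
  (forall k s', k < n -> nmem s' i 0 0 = k -> nmem s' 0 0 0 = n ->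
    frame (i :: nat_writes c) (real_writes c) s s' ->
    I k s' -> I k.+1 (tick i (den c s'))) ->
  I n (den (CFor i c) s).
Proof.
move=> /=/andP[ic wc]; rewrite inE negb_or => /andP[i0 c0] sn I0 IS.
rewrite sn; set f := fun s' => _.
have loop m : m <= n -> [/\ I m (iter m f (put_var i 0 s)),
    nmem (iter m f (put_var i 0 s)) i 0 0 = m
  & frame (i :: nat_writes c) (real_writes c) s (iter m f (put_var i 0 s))];
  last by have [] := loop n (leqnn n).
elim: m => [_|m IHm mn].
  split=> //=; first by rewrite /upd !eqxx.
  by split=> //= a; rewrite inE negb_or => /andP[ai _] *; rewrite upd_other.
have [Im mi fm] := IHm (ltnW mn).
rewrite iterS; set s' := iter m f _ in Im mi fm *.
split.
- by apply: IS => //; have [-> //] := fm; rewrite inE negb_or i0.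
- by rewrite /f /= /upd !eqxx /= den_nmem // mi.
- apply: frame_trans fm _; split=> a /=; last by move=> *; rewrite den_rmem.
  by rewrite inE negb_or => /andP[ai ac] *; rewrite upd_other ?den_nmem.
Qed.

(** An enabled index replaces [best] if [best] is still n or [le] holds; the guard is there because
    [le] is meaningless while [best] is n. *)
Definition scan_step (i best : nat) (en le : bexp) : cmd :=
  CIf (BAnd en (BNot (BAnd (BNot (BLeN (var 0) (var best))) (BNot le))))
    (set_var best (var i)) CSkip.

Definition scan (i best : nat) (en le : bexp) : cmd :=
  CSeq (set_var best (var 0)) (CFor i (scan_step i best en le)).

(* The value n in cell best means that no index is enabled. *)
Lemma scanP (E : pred nat) (LE : rel nat) i best en le s n :
  uniq [:: 0; i; best] -> nmem s 0 0 0 = n ->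
  (forall s', frame [:: i; best] [::] s s' -> nmem s' i 0 0 < n ->
    beval s' en = E (nmem s' i 0 0)) ->
  (forall s', frame [:: i; best] [::] s s' -> nmem s' i 0 0 < n ->
    nmem s' best 0 0 < n -> beval s' le = LE (nmem s' i 0 0) (nmem s' best 0 0)) ->
  total LE -> transitive LE ->
  exists2 s', den (scan i best en le) s = s' /\ frame [:: i; best] [::] s s' &
    (nmem s' best 0 0 = n /\ forall k, k < n -> ~~ E k) \/
    [/\ nmem s' best 0 0 < n, E (nmem s' best 0 0)
      & forall k, k < n -> E k -> LE (nmem s' best 0 0) k].
Proof.
rewrite [uniq _]/= !inE !negb_or andbT => /andP[/andP[zi zb] ib] sn enE leE tot tr.
eexists; first split=> //.
  apply: frame_sub (den_frame (scan i best en le) s) => a //=.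
  by rewrite !inE => /or3P[] /eqP->; rewrite eqxx ?orbT.
set s1 := put_var best n s.
have fs1 : frame [:: i; best] [::] s s1.
  by split=> //= a; rewrite !inE negb_or => /andP[_ ab] *; rewrite upd_other.
have s1n : nmem s1 0 0 0 = n by rewrite /= upd_other.
have -> : den (scan i best en le) s = den (CFor i (scan_step i best en le)) s1.
  by rewrite /s1 -sn.
pose I k (s' : state R) := 
    (nmem s' best 0 0 = n /\ forall j, j < k -> ~~ E j) \/
    [/\ nmem s' best 0 0 < n, E (nmem s' best 0 0)
      & forall j, j < k -> E j -> LE (nmem s' best 0 0) j].
apply: (@den_for I i (scan_step i best en le)) => //=.
- by rewrite inE ib.
- by rewrite !inE negb_or zi.
- by left; split=> //=; rewrite /upd !eqxx eq_sym (negbTE ib).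
move=> k s' kn s'i s'n [fs' rs'] Ik.
have fr : frame [:: i; best] [::] s s'.
  by apply: frame_trans fs1 _; split.
rewrite /scan_step /= enE // s'i // s'n.
have bi : best != i by rewrite eq_sym.
case: ifP => /=; last first.
  move=> cond; rewrite /I /= upd_other //.
  case: Ik => [[bn nE]|[bn Eb minb]].
    left; split=> // j; rewrite ltnS leq_eqVlt => /orP[/eqP->|/nE //].
    by move: cond; rewrite bn leqnn /= andbT => ->.
  right; split=> // j; rewrite ltnS leq_eqVlt => /orP[/eqP->|/minb //] Ek.
  move: cond; rewrite Ek leqNgt bn /= negbK leE // ?s'i // => nle.
  by have := tot k (nmem s' best 0 0); rewrite nle.
move=> /andP[Ek cond]; right; rewrite /tick /= upd_other // /upd !eqxx /=.
split=> // j; rewrite ltnS leq_eqVlt => /orP[/eqP->|jk] Ej.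
  by have := tot k k; rewrite orbb.
case: Ik => [[bn /(_ j jk)]|[bn Eb /(_ j jk Ej) bj]]; first by rewrite Ej.
move: cond; rewrite leqNgt bn /= negbK leE // ?s'i // => kb.
exact: tr kb bj.
Qed.
End Rules.

(** * Reachability among lines *)

Section Crossing.
Local Open Scope ring_scope.
Variable R : realType.
Implicit Types (l : line R) (p q : point R).

(** Cramer's rule: the determinant of the two line equations and, next, the abscissa of their
    solution. *)
Definition cross_det l1 l2 : R := l1.1.1 * l2.1.2 - l2.1.1 * l1.1.2.
Definition cross_x l1 l2 : R :=
  (l1.2 * l2.1.2 - l2.2 * l1.1.2) / cross_det l1 l2.

Lemma on_line_inj l p q : ~~ vertical l -> on_line l p -> on_line l q ->
  p.1 = q.1 -> p = q.
Proof.
case: p q => [x y] [x' y']; rewrite /vertical /on_line /= => b0 /eqP<- /eqP E xx.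
move: E; rewrite xx => /addrI/(mulfI b0) ->; first by [].
Qed.

Lemma cross_xP l1 l2 p : cross_det l1 l2 != 0 ->
  on_line l1 p -> on_line l2 p -> p.1 = cross_x l1 l2.
Proof.
move=> d0 /eqP e1 /eqP e2; apply: (mulIf d0).
by rewrite /cross_x divfK // /cross_det -e1 -e2; ring.
Qed.

Lemma cross_point l1 l2 : cross_det l1 l2 != 0 -> ~~ vertical l1 ->
  exists p, [/\ on_line l1 p, on_line l2 p & p.1 = cross_x l1 l2].
Proof.
rewrite /vertical => d0 b0.
exists (cross_x l1 l2, (l1.2 - l1.1.1 * cross_x l1 l2) / l1.1.2).
rewrite /on_line /= /cross_x; split=> //; apply/eqP.
  by move: d0 b0; rewrite /cross_det => d0 b0; field; rewrite b0 d0.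
by move: d0 b0; rewrite /cross_det => d0 b0; field; rewrite b0 d0.
Qed.

Lemma cross_det0 l1 l2 p : cross_det l1 l2 = 0 ->
  ~~ vertical l1 -> ~~ vertical l2 -> on_line l1 p -> on_line l2 p ->
  on_line l1 =1 on_line l2.
Proof.
case: l1 l2 p => [[a b] c] [[a' b'] c'] [x y].
rewrite /vertical /cross_det /on_line /= => d0 b0 b0' /eqP e /eqP e' [u v] /=.
(* The residuals of the two equations at any (u, v) are proportional, with nonzero factors, so they
   vanish together. *)
have key : (a * u + b * v - c) * b' = (a' * u + b' * v - c') * b.
  apply/eqP; rewrite -subr_eq0 -e -e'; apply/eqP.
  by transitivity ((a * b' - a' * b) * (u - x)); [ring | rewrite d0 mul0r].
apply/eqP/eqP => /eqP; rewrite -subr_eq0 => /eqP E; apply/eqP; rewrite -subr_eq0.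
  by move: key; rewrite E mul0r => /esym/eqP; rewrite mulf_eq0 (negbTE b0) orbF.
by move: key; rewrite E mul0r => /eqP; rewrite mulf_eq0 (negbTE b0') orbF.
Qed.
End Crossing.

(** * Dijkstra's algorithm on the graph of lines *)

Section Reachability.
Local Open Scope ring_scope.
Variables (R : realType) (n : nat) (P : n.-tuple (point R)) (L : n.-tuple (line R)).
Hypothesis PL : point_line_config P L.

Definition nth_point (i : nat) : point R := nth (0, 0) P i.
Definition nth_line (j : nat) : line R := nth (0, 0, 0) L j.

Lemma nth_line_nonvertical j : (j < n)%N -> ~~ vertical (nth_line j).
Proof.
move=> jn; rewrite /nth_line -(tnth_nth _ L (Ordinal jn)).
exact: lines_nonvertical PL _.
Qed.

(** Parallel lines with a common point coincide as sets, and the listed lines are distinct as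
    sets. *)
Lemma nth_line_parallel i j p : (i < n)%N -> (j < n)%N ->
  on_line (nth_line i) p -> on_line (nth_line j) p ->
  cross_det (nth_line i) (nth_line j) = 0 -> i = j.
Proof.
move=> lin ljn ip jp d0.
have := cross_det0 d0 (nth_line_nonvertical lin) (nth_line_nonvertical ljn) ip jp.
rewrite /nth_line -(tnth_nth _ L (Ordinal lin)) -(tnth_nth _ L (Ordinal ljn)).
by move/(lines_distinct PL)/(congr1 val).
Qed.

Lemma reach_refl p : reach L p p. Proof. by exists [::]. Qed.

Lemma reach_rcons p v w : reach L p v -> step L v w -> reach L p w.
Proof.
by move=> [s ps <-] vw; exists (rcons s w); rewrite ?last_rcons // rcons_path ps.
Qed.

Lemma reach_trans p q r : reach L p q -> reach L q r -> reach L p r.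
Proof.
move=> [s ps <-] [s' ps' <-].
by exists (s ++ s'); rewrite ?cat_path ?ps // last_cat.
Qed.

Lemma reach_ltx p q : reach L p q -> p != q -> p.1 < q.1.
Proof.
move=> [s ps <-] {q}.
have: p.1 <= (last p s).1 ?= iff (s == [::]); last first.
  by case: s ps => [|v s] ps [le eq]; rewrite ?eqxx // lt_neqAle le eq.
elim: s p ps => [|v s IH] p /=; first by move=> _; split; rewrite ?eqxx.
case/andP=> /andP[pv _] /IH [le _].
by split; [rewrite ltW // | rewrite lt_eqF //]; apply: lt_le_trans pv le.
Qed.

(** A step moves strictly right, so equal abscissas are treated apart: on a nonvertical line they
    force [v = w]. *)
Lemma reach_along p v w l : (l < n)%N -> reach L p v ->
  on_line (nth_line l) v -> on_line (nth_line l) w -> v.1 <= w.1 -> reach L p w.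
Proof.
move=> lL pv lv lw; rewrite le_eqVlt => /orP[/eqP vw|vw].
  by rewrite -(on_line_inj (nth_line_nonvertical lL) lv lw vw).
apply: reach_rcons pv _; rewrite /step vw; apply/hasP; exists (nth_line l).
  by rewrite mem_nth ?size_tuple.
by rewrite lv lw.
Qed.

(* State of Dijkstra's algorithm on the graph of lines, from the source [p]:
   [dist l] is the leftmost known abscissa at which line [l] can be entered,
   and [status l] is 0 (unreached), 1 (reached) or 2 (settled). *)
Record dijkstra (p : point R) (status : nat -> nat) (dist : nat -> R) : Prop := {
  dijkstra_sound : forall l, (l < n)%N -> status l != 0%N ->
    exists v, [/\ reach L p v, on_line (nth_line l) v & v.1 = dist l];
  dijkstra_source : forall l, (l < n)%N -> on_line (nth_line l) p ->
    status l != 0%N /\ dist l <= p.1;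
  dijkstra_relaxed : forall l l', (l < n)%N -> (l' < n)%N -> status l = 2%N ->
    cross_det (nth_line l) (nth_line l') != 0 ->
    dist l <= cross_x (nth_line l) (nth_line l') ->
    status l' != 0%N /\ dist l' <= cross_x (nth_line l) (nth_line l');
  dijkstra_order : forall l l', (l < n)%N -> (l' < n)%N -> 
    status l = 2%N -> status l' = 1%N -> dist l <= dist l'
}.

(** An unreached line has its own clause because the invariant gives no meaning to its [dist]. *)
Definition relaxable (m : nat) (status : nat -> nat) (dist : nat -> R) l :=
  [&& status l != 2%N, cross_det (nth_line m) (nth_line l) != 0,
    dist m <= cross_x (nth_line m) (nth_line l)
  & (status l == 0%N) || (cross_x (nth_line m) (nth_line l) < dist l)].

Lemma dijkstra_init p (status : nat -> nat) dist :
  (forall l, (l < n)%N -> status l = on_line (nth_line l) p /\ dist l = p.1) ->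
  dijkstra p status dist.
Proof.
move=> init; split.
- move=> l ln_ ; have [-> ->] := init l ln_; case: (boolP (on_line _ _)) => // lp _.
  by exists p; split=> //; apply: reach_refl.
- by move=> l ln_ lp; have [-> ->] := init l ln_; rewrite lp.
- by move=> l l' ln_ _; have [-> _] := init l ln_; case: on_line.
- by move=> l l' ln_ _; have [-> _] := init l ln_; case: on_line.
Qed.

Lemma dijkstra_ext p status dist status' dist' :
  (forall l, (l < n)%N -> status' l = status l /\ dist' l = dist l) ->
  dijkstra p status dist -> dijkstra p status' dist'.
Proof.
move=> E [sound source relaxed order].
have Es l : (l < n)%N -> status' l = status l by move/E=> [].
have Ed l : (l < n)%N -> dist' l = dist l by move/E=> [].
split=> [l lL|l lL|l l' lL lL'|l l' lL lL']; rewrite ?Es ?Ed //.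
- exact: sound.
- exact: source.
- exact: relaxed.
- exact: order.
Qed.

(** As m is leftmost among the pending lines, every relaxed abscissa is at least [dist m]; hence no
    settled line could be improved and the order is kept. *)
Lemma dijkstra_step p status dist status' dist' m :
  dijkstra p status dist -> (m < n)%N -> status m = 1%N ->
  (forall l, (l < n)%N -> status l = 1%N -> dist m <= dist l) ->
  let status2 l := if l == m then 2%N else status l in
  (forall l, (l < n)%N ->
    status' l = (if relaxable m status2 dist l then 1%N else status2 l) /\
    dist' l = (if relaxable m status2 dist l then cross_x (nth_line m) (nth_line l)
               else dist l)) ->
  dijkstra p status' dist'.
Proof.
move=> D mn sm minm status2 new.
(* Three comparisons with the old state: settled lines lie at or left of [dist m], pending ones at
   or right of it, and no reached line loses ground. *)
have settled l : (l < n)%N -> status' l = 2%N ->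
    [/\ dist' l = dist l, dist l <= dist m & l = m \/ status l = 2%N].
  move=> lL; have [-> ->] := new l lL; case: ifP => // _.
  rewrite /status2; have [-> _|_ sl] := eqVneq l m; first by split=> //; left.
  by split=> //; [apply: (dijkstra_order D) | right].
have pending l : (l < n)%N -> status' l = 1%N -> dist m <= dist' l.
  move=> lL; have [-> ->] := new l lL; case: ifP => [/and4P[]//|_].
  by rewrite /status2; case: (l == m) => //; apply: minm.
have keep l : (l < n)%N -> status l != 0%N -> status' l != 0%N /\ dist' l <= dist l.
  move=> lL sl; have [-> ->] := new l lL; case: ifP => [/and4P[_ _ _]|_].
    rewrite /status2; have [_|_] := eqVneq l m; rewrite ?(negbTE sl) /= => lt;
    by split=> //; apply: ltW.
  by rewrite /status2; case: (l == m).
split.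
- move=> l lL; have [-> ->] := new l lL; case: ifP => [/and4P[_ d0 le _] _|_].
    (* Enter m where it is known to be reachable, then walk right along it to the crossing. *)
    have [|v [pv mv vx]] := dijkstra_sound D mn; first by rewrite sm.
    have [w [mw lw wx]] := cross_point d0 (nth_line_nonvertical mn).
    exists w; split=> //; apply: reach_along mn pv mv mw _.
    by rewrite vx wx.
  rewrite /status2; have [->|_] := eqVneq l m; last exact: dijkstra_sound.
  by move=> _; apply: (dijkstra_sound D mn); rewrite sm.
- move=> l lL /(dijkstra_source D lL)[sl dl].
  have [sl' dl'] := keep l lL sl; split=> //; exact: le_trans dl' dl.
- move=> l l' lL lL' sl d0.
  have [-> lm [lE|sl2]] := settled l lL sl.
    subst l => le; have [-> ->] := new l' lL'.
    case: ifP => //; rewrite /relaxable d0 le /= /status2.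
    have [E|_] /= := eqVneq l' m; first by move: d0; rewrite E /cross_det subrr eqxx.
    (* A settled line is already entered at or left of [dist m], hence of the crossing. *)
    have [sl2 _|_] := eqVneq (status l') 2%N.
      by split; [rewrite sl2 | apply: le_trans le; apply: (dijkstra_order D)].
    by move=> /negbT; rewrite negb_or -leNgt => /andP.
  move=> le; have [sl' dl'] := dijkstra_relaxed D lL lL' sl2 d0 le.
  have [s d] := keep l' lL' sl'; split=> //; exact: le_trans d dl'.
- move=> l l' lL lL' sl sl'.
  have [-> lm _] := settled l lL sl; exact: le_trans lm (pending l' lL' sl').
Qed.

(** With no line pending, the distances are closed under relaxation, so a path can be followed
    vertex by vertex. Conversely, a line through q entered at or left of q leads to q. *)
Lemma dijkstra_reach p q status dist : 
  dijkstra p status dist -> (forall l, (l < n)%N -> status l = 0%N \/ status l = 2%N) ->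
  (exists2 l, (l < n)%N & on_line (nth_line l) q) ->
  reach L p q <-> exists l, [/\ (l < n)%N, status l != 0%N, on_line (nth_line l) q
                             & dist l <= q.1].
Proof.
move=> D final [l0 l0L l0q]; split; last first.
  move=> [l [lL sl lq le]]; have [v [pv lv vx]] := dijkstra_sound D lL sl.
  by apply: reach_along lL pv lv lq _; rewrite vx.
move=> [s ps qE].
(* The claim covers all lines through the endpoint of the path, since the next step may take any of
   them. *)
have arrive v s' : path (step L) p s' -> last p s' = v ->
    forall l, (l < n)%N -> on_line (nth_line l) v -> status l != 0%N /\ dist l <= v.1.
  elim/last_ind: s' v => [|s' w IH] v; first by move=> _ <- l; apply: dijkstra_source.
  rewrite rcons_path last_rcons.
  move=> /andP[ps' /andP[lt /hasP[l' l'L /andP[l'u l'v]]]] wv l lL lv.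
  subst v; set u := last p s' in lt l'u.
  have [k kL lk] : exists2 k, (k < n)%N & l' = nth_line k.
    move: l'L => /(nthP (0, 0, 0))[k]; rewrite size_tuple => kL <-; by exists k.
  rewrite {l' l'L}lk in l'u l'v.
  have [sk dk] := IH u ps' erefl k kL l'u.
  have {}dk : dist k <= w.1 by apply: le_trans dk (ltW lt).
  (* A parallel line through the same point is the current line itself; otherwise the point is the
     crossing and relaxation applies. *)
  have [d0|d0] := eqVneq (cross_det (nth_line k) (nth_line l)) 0.
    by rewrite -(nth_line_parallel kL lL l'v lv d0).
  rewrite (cross_xP d0 l'v lv) in dk *.
  apply: (dijkstra_relaxed D) => //.
  by case: (final k kL) sk => // ->.
have [sl dl] := arrive q s ps qE l0 l0L l0q.
by exists l0.
Qed.
End Reachability.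

(** * Antichains and auctions *)

(* Each matched v is charged to v itself if v lies above B and to its mate
   otherwise; the charged elements are distinct and avoid B. *)
Lemma antichain_matching (T : finType) (adj : rel T) (B M : {set T})
    (mate : T -> T) :
  transitive adj -> {in B &, forall i j, ~~ adj i j} ->
  {in M, forall v, adj (mate v) v} -> {in M &, injective mate} ->
  #|B| + #|M| <= #|T|.
Proof.
move=> tr anti madj minj.
pose above v := [exists b in B, adj b v].
pose f v := if above v then v else mate v.
(* By transitivity, a charge to a mate is never above B, while a charge to itself is; so the two
   kinds cannot collide. *)
have mate_below v : v \in M -> ~~ above v -> ~~ above (mate v).
  move=> vM; apply: contra => /exists_inP[b bB bv]; apply/exists_inP; exists b => //.
  exact: tr bv (madj v vM).
have finj : {in M &, injective f}.
  move=> v w vM wM; rewrite /f.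
  case: (boolP (above v)) (boolP (above w)) => [av|nv] [aw|nw] //.
  - by move=> E; move: (mate_below w wM nw); rewrite -E av.
  - by move=> E; move: (mate_below v vM nv); rewrite E aw.
  - exact: minj.
rewrite -(cardsC B) leq_add2l -(card_in_imset finj).
apply/subset_leq_card/subsetP => _ /imsetP[v vM ->]; rewrite inE /f.
case: (boolP (above v)) => [/exists_inP[b bB bv]|nv]; apply/negP => vB.
  by have := anti b v bB vB; rewrite bv.
by case/negP: nv; apply/exists_inP; exists (mate v); rewrite ?madj.
Qed.

(** * The auction: invariant, potential and optimality *)

Section Auction.
Variables (n : nat) (adj : rel nat).

(* Invariant of an auction for the bipartite graph [adj]: [label v] is the
   price of right vertex [v], zero exactly while [v] is unmatched, and
   [status u] is 0 (active), 1 (matched) or 2 (retired). *)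
Record auction (label mate status : nat -> nat) : Prop := {
  auction_bound : forall v, v < n -> label v <= n.+1;
  auction_mate : forall v, v < n -> 0 < label v ->
    [/\ mate v < n, adj (mate v) v & status (mate v) = 1];
  auction_inj : forall v w, v < n -> w < n -> 0 < label v -> 0 < label w ->
    mate v = mate w -> v = w;
  auction_slack : forall v w, v < n -> w < n -> 0 < label v ->
    adj (mate v) w -> label v <= (label w).+1;
  auction_retired : forall u w, u < n -> w < n -> status u = 2 ->
    adj u w -> n < label w;
  auction_status : forall u, u < n ->
    [\/ status u = 0, status u = 2
      | exists v, [/\ v < n, 0 < label v & mate v = u]]
}.

(** Every effective bid raises it by one: a price goes up or a left vertex retires. Evictions leave
    it alone, since statuses 0 and 1 count alike. *)
Definition potential (label status : nat -> nat) : nat :=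
  \sum_(i < n) (label i + (status i == 2)).

Lemma sum_incr (F F' : nat -> nat) v : v < n ->
  (forall i, i < n -> F' i = F i + (i == v)) ->
  \sum_(i < n) F' i = (\sum_(i < n) F i).+1.
Proof.
move=> vn FF'.
rewrite (eq_bigr (fun i : 'I_n => F i + (i == Ordinal vn))); last first.
  by move=> i _; rewrite FF'.
rewrite big_split /= -[RHS]addn1; congr (_ + _).
rewrite (bigD1 (Ordinal vn)) //= eqxx big1 // => i /negbTE.
by rewrite -val_eqE => ->.
Qed.

Lemma potential_bound label mate status : auction label mate status ->
  potential label status <= n * n.+2.
Proof.
move=> A; rewrite /potential; apply: (@leq_trans (\sum_(i < n) n.+2)); last first.
  by rewrite sum_nat_const card_ord.
apply: leq_sum => i _; have := auction_bound A (ltn_ord i).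
by case: (_ == _); lia.
Qed.

Lemma auction_ext label mate status label' mate' status' :
  (forall i, i < n ->
    [/\ label' i = label i, mate' i = mate i & status' i = status i]) ->
  auction label mate status ->
  auction label' mate' status' /\
  potential label' status' = potential label status.
Proof.
move=> E [bound mated inj slack ret stat].
have El i : i < n -> label' i = label i by case/E.
have Em i : i < n -> mate' i = mate i by case/E.
have Es i : i < n -> status' i = status i by case/E.
split; last by apply: eq_bigr => i _; rewrite El ?Es.
split=> [v vn|v vn|v w vn wn|v w vn wn|u w un wn|u un];
  rewrite ?El ?Em //.
- exact: bound.
- by move=> lv; have [mn mv sv] := mated v vn lv; rewrite Es.
- exact: inj.
- exact: slack.
- by rewrite Es //; apply: ret.
have [s0|s2|[v [vn lv mv]]] := stat u un.
- by constructor 1; rewrite Es.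
- by constructor 2; rewrite Es.
- by constructor 3; exists v; rewrite El ?Em.
Qed.

Lemma auction_init label mate status :
  (forall v, v < n -> label v = 0) -> (forall u, u < n -> status u = 0) ->
  auction label mate status.
Proof.
move=> l0 s0; split=> [v vn|v vn|v w vn wn|v w vn wn|u w un wn|u un];
  rewrite ?l0 //; first by rewrite s0.
by constructor 1; rewrite s0.
Qed.

Lemma auction_retire label mate status status' u :
  auction label mate status -> u < n -> status u = 0 ->
  (forall w, w < n -> adj u w -> n < label w) ->
  (forall i, i < n -> status' i = if i == u then 2 else status i) ->
  auction label mate status' /\
  potential label status' = (potential label status).+1.
Proof.
move=> A un su uret new; split; last first.
  apply: (@sum_incr (fun i => label i + (status i == 2))
                    (fun i => label i + (status' i == 2)) u) => // i lin.
  by rewrite new //; have [->|_] := eqVneq i u; rewrite ?su /= ?addn0.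
split.
- exact: auction_bound A.
- move=> v vn lv; have [mn mv sv] := auction_mate A vn lv; split=> //.
  by rewrite new //; case: eqP => // E; move: sv; rewrite E su.
- exact: auction_inj A.
- exact: auction_slack A.
- move=> w v wn vn; rewrite new //; case: eqP => [-> _|_]; first exact: uret.
  exact: auction_retired A _ _ wn vn.
- move=> w wn; rewrite new //; case: eqP => [_|_]; first by constructor 2.
  exact: auction_status A _ wn.
Qed.

(** Slack survives because v is cheapest for u: its raised price exceeds that of any successor of u
    by at most one, and prices never fall. *)
Lemma auction_match label mate status label' mate' status' u v :
  auction label mate status -> u < n -> status u = 0 ->
  v < n -> adj u v -> (forall w, w < n -> adj u w -> label v <= label w) ->
  label v <= n ->
  (forall i, i < n -> label' i = label i + (i == v)) ->
  (forall i, i < n -> mate' i = if i == v then u else mate i) ->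
  (forall i, i < n -> status' i =
     if i == u then 1
     else if (0 < label v) && (i == mate v) then 0 else status i) ->
  auction label' mate' status' /\
  potential label' status' = (potential label status).+1.
Proof.
move=> A un su vn uv vmin lvn labE mateE statE.
have mate_u w : w < n -> 0 < label w -> mate w != u.
  move=> wn lw; have [_ _ sw] := auction_mate A wn lw.
  by apply: contra_eq_neq sw => ->; rewrite su.
(* The evicted owner was matched, so the set of retired vertices does not change. *)
have stat2 i : i < n -> (status' i == 2) = (status i == 2).
  move=> lin; rewrite statE //; have [->|_] := eqVneq i u; first by rewrite su.
  case: ifP => // /andP[lv /eqP->].
  by have [_ _ ->] := auction_mate A vn lv.
split; last first.
  apply: (@sum_incr (fun i => label i + (status i == 2))
                    (fun i => label' i + (status' i == 2)) v) => // i lin.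
  by rewrite labE // stat2 // addnAC.
have le_lab i : i < n -> label i <= label' i by move=> lin; rewrite labE // leq_addr.
split.
- move=> w wn; rewrite labE //; case: eqP => [->|_]; first by rewrite addn1.
  by rewrite addn0 (auction_bound A).
- move=> w wn; rewrite labE // mateE //; have [->|wv] := eqVneq w v.
    by move=> _; split=> //; rewrite statE // eqxx.
  rewrite addn0 => lw; have [mn mw sw] := auction_mate A wn lw; split=> //.
  rewrite statE // (negbTE (mate_u w wn lw)).
  case: ifP => // /andP[lv /eqP E]; case/eqP: wv.
  exact: auction_inj A _ _ wn vn lw lv E.
- move=> w w' wn wn'; rewrite !labE // !mateE //.
  have [->|wv] := eqVneq w v; have [->|wv'] := eqVneq w' v => //; rewrite ?addn0.
  + by move=> _ lw' /eqP; rewrite eq_sym (negbTE (mate_u _ wn' lw')).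
  + by move=> lw _ /eqP; rewrite (negbTE (mate_u _ wn lw)).
  + exact: auction_inj A _ _ wn wn'.
- move=> w w' wn wn'; rewrite labE // mateE //; have [->|wv] := eqVneq w v.
    move=> _ /(vmin w' wn') lv; rewrite addn1 ltnS.
    exact: leq_trans lv (le_lab _ wn').
  rewrite addn0 => lw mw; have := auction_slack A wn wn' lw mw.
  by have := le_lab w' wn'; lia.
- move=> i w lin wn /eqP; rewrite stat2 // => /eqP si iw.
  exact: leq_trans (auction_retired A lin wn si iw) (le_lab w wn).
- move=> i lin; rewrite statE //; have [->|iu] := eqVneq i u.
    by constructor 3; exists v; rewrite labE // mateE // eqxx addn1.
  case: ifP => [_|nm]; first by constructor 1.
  have [s0|s2|[w [wn lw mw]]] := auction_status A lin.
  + by constructor 1.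
  + by constructor 2.
  + constructor 3; exists w; split=> //; first exact: leq_trans lw (le_lab _ wn).
    rewrite mateE //; case: eqP => // E; subst w.
    by move: nm; rewrite lw mw eqxx.
Qed.

(** Pigeonhole: n vertices carry at most n distinct prices. *)
Lemma surjective_labels (label : nat -> nat) m :
  (forall j, 0 < j <= m -> exists2 v, v < n & label v = j) -> m <= n.
Proof.
move=> surj; rewrite -(size_iota 1 m) -(size_iota 0 n) -(size_map label (iota 0 n)).
apply: uniq_leq_size (iota_uniq _ _) _ => j; rewrite mem_iota add1n ltnS.
move=> /surj[v vn <-]; by rewrite map_f // mem_iota.
Qed.

(** The first conjunct says that the right copy of i is outside the vertex cover of level k, the
    second that its left copy is. *)
Definition auction_output (label mate : nat -> nat) (k : nat) : {set 'I_n} :=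
  [set i : 'I_n | (label i <= k) &&
     ~~ [exists v : 'I_n, (0 < label v <= k) && (mate v == i)]].

(* A level [k.+1] of prices that is not attained splits the matched pairs
   into a vertex cover: right ends above the level, left ends below it. *)
Lemma auction_optimal label mate status k :
  (forall i j l, i < n -> j < n -> l < n -> adj i j -> adj j l -> adj i l) ->
  (forall i, i < n -> ~~ adj i i) ->
  auction label mate status -> (forall u, u < n -> status u != 0) ->
  k <= n -> (forall v, v < n -> label v != k.+1) ->
  let A := auction_output label mate k in
  {in A &, forall i j : 'I_n, ~~ adj i j} /\
  forall B : {set 'I_n}, {in B &, forall i j : 'I_n, ~~ adj i j} -> #|B| <= #|A|.
Proof.
move=> tr irr A active0 kn gap; rewrite /auction_output; set C := [set i | _].
split.
  move=> i j; rewrite !inE => /andP[_ ni] /andP[lj _]; apply/negP => ij.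
  have [s0|s2|[v [vn lv mv]]] := auction_status A (ltn_ord i).
  - by move: (active0 i (ltn_ord i)); rewrite s0.
  - have := auction_retired A (ltn_ord i) (ltn_ord j) s2 ij; lia.
  (* Here i owns v, priced at most k + 1 by slack, hence at most k by the gap; so the left copy of i
     is in the cover. *)
  - have := auction_slack A vn (ltn_ord j) lv; rewrite mv => /(_ ij) slack.
    case/existsP: ni; exists (Ordinal vn); rewrite /= mv eqxx lv andbT /=.
    by have := gap v vn; lia.
move=> B antiB.
pose M := [set v : 'I_n | 0 < label v].
pose mt (v : 'I_n) : 'I_n := insubd v (mate v).
have mtE v : v \in M -> mt v = mate v :> nat.
  by rewrite inE => lv; rewrite val_insubd; have [-> //] := auction_mate A (ltn_ord v) lv.
have BM : #|B| + #|M| <= n.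
  rewrite -[leqRHS]card_ord.
  apply: (@antichain_matching _ (fun i j : 'I_n => adj i j) B M mt) => //.
  - by move=> j i l; apply: tr.
  - move=> v vM; rewrite mtE //; move: vM; rewrite inE => lv.
    by have [] := auction_mate A (ltn_ord v) lv.
  - move=> v w vM wM /(congr1 val) /=; rewrite !mtE //.
    move: vM wM; rewrite !inE => lv lw E; apply: val_inj.
    exact: auction_inj A _ _ _ _ lv lw E.
(* Each index outside C is charged to a matched right vertex: itself if priced above k, else one
   that it owns, priced at most k. So there are at most as many as matched pairs. *)
have: ~: C \subset [set v in M | k < label v] :|: mt @: [set v in M | label v <= k].
  apply/subsetP => i; rewrite !inE negb_and negbK -ltnNge => /orP[ki|].
    by rewrite ki (leq_ltn_trans _ ki).
  move=> /existsP[v /andP[/andP[lv vk] /eqP mv]]; apply/orP; right.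
  apply/imsetP; exists v; first by rewrite !inE lv.
  by apply: val_inj; rewrite /= mtE ?inE.
move=> /subset_leq_card/leq_trans/(_ (leq_card_setU _ _)) le1.
have le2 : #|mt @: [set v in M | label v <= k]| <= #|[set v in M | label v <= k]|.
  exact: leq_imset_card.
have: #|[set v in M | k < label v]| + #|[set v in M | label v <= k]| = #|M|.
  rewrite -(cardsID [set v : 'I_n | k < label v] M); congr addn.
    by apply: eq_card => v; rewrite !inE.
  by apply: eq_card => v; rewrite !inE -leqNgt andbC.
move=> cM; rewrite -(leq_add2r #|M|); apply: leq_trans BM _.
rewrite -[leqLHS]card_ord -(cardsC C) leq_add2l -cM.
by apply: leq_trans le1 _; rewrite leq_add2l.
Qed.
End Auction.

(** * The program *)

(* [ADJ], [LAB] and [STAT] are read before they are written: the initial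
   contents 0 of the memory are used. *)
Notation SIZE := 0 (only parsing).
Notation OUT := 1 (only parsing).
Notation ADJ := 2 (only parsing).
Notation SRC := 3 (only parsing).
Notation LN := 4 (only parsing).
Notation BEST := 5 (only parsing).
Notation RND := 6 (only parsing).
Notation ST := 7 (only parsing).
Notation TGT := 8 (only parsing).
Notation LAB := 9 (only parsing).
Notation MATE := 10 (only parsing).
Notation STAT := 11 (only parsing).
Notation ROW := 12 (only parsing).
Notation COL := 13 (only parsing).
Notation SCAN := 14 (only parsing).
Notation UU := 15 (only parsing).
Notation VV := 16 (only parsing).
Notation LEV := 17 (only parsing).
Notation DIST := 2 (only parsing).

Definition ltN (e1 e2 : nexp) : bexp := BNot (BLeN e2 e1).
Definition eqN (e1 e2 : nexp) : bexp := BAnd (BLeN e1 e2) (BLeN e2 e1).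
Definition ltR (e1 e2 : rexp) : bexp := BNot (BLeR e2 e1).
Definition eqR (e1 e2 : rexp) : bexp := BAnd (BLeR e1 e2) (BLeR e2 e1).
Definition orB (b1 b2 : bexp) : bexp := BNot (BAnd (BNot b1) (BNot b2)).

Definition coord (q : nexp) (j : nat) : rexp := RGet 0 q (NConst j).
Definition coef (l : nexp) (j : nat) : rexp := RGet 1 l (NConst j).
Definition dist (l : nexp) : rexp := RGet DIST l (NConst 0).

Definition on_line_test (l q : nexp) : bexp :=
  eqR (RAdd (RMul (coef l 0) (coord q 0)) (RMul (coef l 1) (coord q 1)))
      (coef l 2).
Definition cross_det_exp (l1 l2 : nexp) : rexp :=
  RSub (RMul (coef l1 0) (coef l2 1)) (RMul (coef l2 0) (coef l1 1)).
Definition cross_x_exp (l1 l2 : nexp) : rexp :=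
  RDiv (RSub (RMul (coef l1 2) (coef l2 1)) (RMul (coef l2 2) (coef l1 1)))
       (cross_det_exp l1 l2).


Section Tests.
Variable R : realType.
Implicit Type s : state R.

Lemma den_seq c1 c2 s : den (CSeq c1 c2) s = den c2 (den c1 s).
Proof. by []. Qed.

Lemma den_if b c1 c2 s :
  den (CIf b c1 c2) s = if beval s b then den c1 s else den c2 s.
Proof. by []. Qed.

Lemma beval_and s b1 b2 : beval s (BAnd b1 b2) = beval s b1 && beval s b2.
Proof. by []. Qed.

Lemma beval_leR s e1 e2 : beval s (BLeR e1 e2) = (reval s e1 <= reval s e2)%R.
Proof. by []. Qed.

Lemma beval_not s b : beval s (BNot b) = ~~ beval s b.
Proof. by []. Qed.

Lemma beval_ltN s e1 e2 : beval s (ltN e1 e2) = (neval s e1 < neval s e2).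
Proof. by rewrite /= ltnNge. Qed.

Lemma beval_eqN s e1 e2 : beval s (eqN e1 e2) = (neval s e1 == neval s e2).
Proof. by rewrite /= eqn_leq. Qed.

Lemma beval_ltR s e1 e2 : beval s (ltR e1 e2) = (reval s e1 < reval s e2)%R.
Proof. by rewrite /= ltNge. Qed.

Lemma beval_eqR s e1 e2 : beval s (eqR e1 e2) = (reval s e1 == reval s e2).
Proof. by rewrite /= eq_le. Qed.

Lemma beval_orB s b1 b2 : beval s (orB b1 b2) = beval s b1 || beval s b2.
Proof. by rewrite /= negb_and !negbK. Qed.
End Tests.
Opaque ltN eqN ltR eqR orB.

(** * The reachability program *)

Definition init_body : cmd :=
  CSeq (CIf (on_line_test (var LN) (var SRC))
            (set_cell ST (var LN) (NConst 1)) (set_cell ST (var LN) (NConst 0)))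
       (CSetR DIST (var LN) (NConst 0) (coord (var SRC) 0)).

(** The clauses follow [relaxable]. With a zero determinant the quotient still has a value, which
    the conjunction discards. *)
Definition relax_test : bexp :=
  BAnd (BNot (eqN (cell ST (var LN)) (NConst 2)))
 (BAnd (BNot (eqR (cross_det_exp (var BEST) (var LN)) RZero))
 (BAnd (BLeR (dist (var BEST)) (cross_x_exp (var BEST) (var LN)))
       (orB (eqN (cell ST (var LN)) (NConst 0))
            (ltR (cross_x_exp (var BEST) (var LN)) (dist (var LN)))))).

Definition relax_body : cmd :=
  CIf relax_test
    (CSeq (CSetR DIST (var LN) (NConst 0) (cross_x_exp (var BEST) (var LN)))
          (set_cell ST (var LN) (NConst 1)))
    CSkip.

(** With no pending line the scan returns n and the round settles nothing, so a fixed number n of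
    rounds is safe. *)
Definition settle : cmd :=
  CSeq (scan LN BEST (eqN (cell ST (var LN)) (NConst 1))
                     (BLeR (dist (var LN)) (dist (var BEST))))
  (CIf (ltN (var BEST) (var SIZE))
    (CSeq (set_cell ST (var BEST) (NConst 2)) (CFor LN relax_body))
    CSkip).

(** The strict comparison of abscissas removes the empty path from a point to itself. *)
Definition arrive_test : bexp :=
  BAnd (BNot (eqN (cell ST (var LN)) (NConst 0)))
 (BAnd (on_line_test (var LN) (var TGT))
 (BAnd (BLeR (dist (var LN)) (coord (var TGT) 0))
       (ltR (coord (var SRC) 0) (coord (var TGT) 0)))).

Definition collect_body : cmd :=
  CIf arrive_test (CSetN ADJ (var SRC) (var TGT) (NConst 1)) CSkip.

Definition source_body : cmd :=
  CSeq (CFor LN init_body)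
  (CSeq (CFor RND settle)
        (CFor TGT (CFor LN collect_body))).

Definition reach_cmd : cmd := CFor SRC source_body.

(** * Correctness of the reachability program *)

Section ReachProgram.
Variables (R : realType) (n : nat) (P : n.-tuple (point R)) (L : n.-tuple (line R)).
Hypothesis PL : point_line_config P L.
Implicit Type s : state R.
Local Notation nth_point := (nth_point P).
Local Notation nth_line := (nth_line L).

Definition holds_input s : Prop :=
  nmem s SIZE 0 0 = n /\
  forall a, a < 2 -> forall i j, rmem s a i j = rmem (input P L) a i j.

Lemma holds_input_frame ws wr s s' : SIZE \notin ws -> 0 \notin wr -> 1 \notin wr ->
  frame ws wr s s' -> holds_input s -> holds_input s'.
Proof.
move=> w0 r0 r1 [fn fr] [sn sr]; split; first by rewrite fn.
by move=> [|[|//]] _ i j; rewrite fr ?sr.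
Qed.

Lemma reval_coord0 s q : holds_input s -> reval s (coord q 0) = (nth_point (neval s q)).1.
Proof. by move=> [_ /= ->]. Qed.

Lemma beval_on_line s l q : holds_input s ->
  beval s (on_line_test l q) = on_line (nth_line (neval s l)) (nth_point (neval s q)).
Proof. by move=> [_ sr]; rewrite beval_eqR /= !sr. Qed.

Lemma reval_cross_det s l1 l2 : holds_input s ->
  reval s (cross_det_exp l1 l2) =
    cross_det (nth_line (neval s l1)) (nth_line (neval s l2)).
Proof. by move=> [_ sr]; rewrite /= !sr. Qed.

Lemma reval_cross_x s l1 l2 : holds_input s ->
  reval s (cross_x_exp l1 l2) = cross_x (nth_line (neval s l1)) (nth_line (neval s l2)).
Proof. by move=> sr; have [_ E] := sr; rewrite /= !E. Qed.

Opaque on_line_test cross_det_exp cross_x_exp.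

Local Notation status s := (fun l => nmem s ST l 0).
Local Notation distance s := (fun l => rmem s DIST l 0).

Lemma init_linesP s i : holds_input s -> nmem s SRC 0 0 = i ->
  let s' := den (CFor LN init_body) s in
  dijkstra L (nth_point i) (status s') (distance s') /\
  forall l, l < n -> status s' l <= 2.
Proof.
move=> hs si s'.
pose I k (s1 : state R) := forall l, l < k ->
  nmem s1 ST l 0 = on_line (nth_line l) (nth_point i) /\
  rmem s1 DIST l 0 = (nth_point i).1.
have Is' : I n s'.
  apply: (@den_for _ I) => //; first by case: hs.
  move=> k s1 kn s1k _ fr Ik.
  have h1 : holds_input s1 by apply: holds_input_frame fr hs.
  have s1i : nmem s1 SRC 0 0 = i by have [-> ] := fr.
  move=> l; rewrite ltnS leq_eqVlt /init_body den_seq den_if beval_on_line //.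
  rewrite [neval _ (var LN)]/= [neval _ (var SRC)]/= s1k s1i.
  have [->|lk] := eqVneq l k => /=.
    by case: ifP => _ /=; rewrite /upd /= ?eqxx /= s1k s1i !eqxx; case: h1 => _ ->.
  move=> /Ik [<- <-].
  by case: ifP => _ /=; rewrite /upd /= ?eqxx /= s1k (negbTE lk).
split; first by apply: dijkstra_init.
by move=> l /Is'[-> _]; case: on_line.
Qed.

Definition settled_count s : nat := \sum_(l < n) (nmem s ST l 0 == 2).

(** After n rounds both alternatives exclude pending lines: none is left, or all n lines are
    settled. *)
Definition progress r s : Prop :=
  (forall l, l < n -> nmem s ST l 0 != 1) \/ r <= settled_count s.

(** Updating in place amounts to updating simultaneously: each line is examined once, before it
    changes, and the settled line m keeps its [dist]. *)
Lemma relax_loopP s m : holds_input s -> m < n -> nmem s BEST 0 0 = m ->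
  nmem s ST m 0 = 2 ->
  let s' := den (CFor LN relax_body) s in
  forall l, l < n ->
    status s' l = (if relaxable L m (status s) (distance s) l then 1
                   else status s l) /\
    distance s' l = (if relaxable L m (status s) (distance s) l
                     then cross_x (nth_line m) (nth_line l) else distance s l).
Proof.
move=> hs mn sm stm s'.
pose relaxed k l := (l < k) && relaxable L m (status s) (distance s) l.
pose I k (s1 : state R) := forall l, l < n ->
  status s1 l = (if relaxed k l then 1 else status s l) /\
  distance s1 l = (if relaxed k l then cross_x (nth_line m) (nth_line l)
                   else distance s l).
have Is' : I n s'.
  apply: (@den_for _ I) => //; first by case: hs.
  move=> k s1 kn s1k _ fr Ik.
  have h1 : holds_input s1 by apply: holds_input_frame fr hs.
  have s1m : nmem s1 BEST 0 0 = m by have [-> ] := fr.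
  have dm : distance s1 m = distance s m.
    by have [_ ->] := Ik m mn; rewrite /relaxed /relaxable stm /= andbF.
  have [stk dk] := Ik k kn; rewrite /relaxed ltnn /= in stk dk.
  have test : beval s1 relax_test = relaxable L m (status s) (distance s) k.
    rewrite /relax_test !beval_and beval_orB beval_ltR !beval_not !beval_eqN.
    rewrite beval_eqR beval_leR !reval_cross_x // reval_cross_det //.
    by rewrite /= s1m s1k /relaxable -stk -dk -dm.
  rewrite /relax_body den_if test => l lL; have [stl dl] := Ik l lL.
  rewrite /relaxed ltnS leq_eqVlt; have [E|lk] := eqVneq l k.
    rewrite E /=; case: ifP => _ /=; rewrite /upd //= s1k eqxx /=.
    by rewrite reval_cross_x //= s1m s1k.
  by case: ifP => _ /=; rewrite /upd //= s1k (negbTE lk).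
by move=> l lL; have [-> ->] := Is' l lL; rewrite /relaxed lL.
Qed.

Lemma settleP s p r : holds_input s ->
  dijkstra L p (status s) (distance s) -> (forall l, l < n -> status s l <= 2) ->
  progress r s ->
  let s' := den settle s in
  [/\ dijkstra L p (status s') (distance s'),
      forall l, l < n -> status s' l <= 2 & progress r.+1 s'].
Proof.
move=> hs D le2 pr s'.
have [||||||s1 [s1E fr] res] := @scanP _ (fun l => status s l == 1)
  (fun a b => distance s a <= distance s b)%R LN BEST
  (eqN (cell ST (var LN)) (NConst 1)) (BLeR (dist (var LN)) (dist (var BEST))) s n.
- by [].
- by case: hs.
- by move=> s2 [f2 _] _; rewrite beval_eqN /= f2.
- by move=> s2 [_ f2] _ _; rewrite beval_leR /= !f2.
- by move=> a b; apply: le_total.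
- by move=> b a c; apply: le_trans.
have h1 : holds_input s1 by apply: holds_input_frame fr hs.
have st1 l : status s1 l = status s l by have [-> ] := fr.
have d1 l : distance s1 l = distance s l by have [_ ->] := fr.
rewrite /s' /settle den_seq s1E den_if beval_ltN.
have -> : neval s1 (var SIZE) = n by case: h1.
rewrite [neval _ _]/=; case: res => [[-> none]|[mn /eqP stm minm]].
  rewrite ltnn; split.
  - by apply: dijkstra_ext D.
  - by move=> l lL; rewrite st1 le2.
  - by left => l lL; rewrite st1; apply: none.
rewrite mn; set m := nmem s1 5 0 0 in mn stm minm *.
rewrite den_seq; set s2 := den (set_cell _ _ _) s1.
have h2 : holds_input s2 by [].
have st2 l : status s2 l = if l == m then 2 else status s l.
  by rewrite /= /upd /= andbT; case: eqP.
have st2m : status s2 m = 2 by rewrite st2 eqxx.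
have := relax_loopP h2 mn (erefl _) st2m; set s3 := den _ s2; cbv zeta.
have relaxE l : relaxable L m (status s2) (distance s2) l =
    relaxable L m (fun l => if l == m then 2 else status s l) (distance s) l.
  by rewrite /relaxable st2 /= !d1.
move=> new; have {}new l : l < n ->
    status s3 l = (if relaxable L m (fun l => if l == m then 2 else status s l)
                        (distance s) l
                   then 1 else if l == m then 2 else status s l) /\
    distance s3 l = (if relaxable L m (fun l => if l == m then 2 else status s l)
                        (distance s) l
                     then cross_x (nth_line m) (nth_line l) else distance s l).
  by move=> lL; have [-> ->] := new l lL; rewrite relaxE -st2 d1.
split.
- exact: (dijkstra_step PL D mn stm (fun l lL st => minm l lL (introT eqP st)) new).
- move=> l lL; have [-> _] := new l lL.
  by case: ifP => // _; case: ifP => // _; apply: le2.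
case: pr => [none|cnt]; first by move: (none m mn); rewrite stm.
(* Line m is newly settled, and relaxation changes no settled line. *)
right; apply: leq_trans (_ : r.+1 <= (settled_count s).+1) _ => //.
rewrite /settled_count -(@sum_incr n (fun l => (status s l == 2)%N)
  (fun l => (status s3 l == 2)%N) m) // => l lL.
have [-> _] := new l lL; rewrite /relaxable.
have [->|lm] := eqVneq l m; first by rewrite /= stm.
by rewrite addn0; case: ifP => // /and4P[/negbTE->].
Qed.

Lemma settled_final s : (forall l, l < n -> status s l <= 2) -> progress n s ->
  forall l, l < n -> status s l = 0 \/ status s l = 2.
Proof.
move=> le2 [none|full] l lL.
  by have := none l lL; have := le2 l lL; case: (nmem s ST l 0) => [|[|[|]]] //; auto.
right; apply/eqP; apply: contraTT full => nl; rewrite -ltnNge /settled_count.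
rewrite (bigD1 (Ordinal lL)) //= (negbTE nl) add0n.
apply: (@leq_ltn_trans (\sum_(i < n | i != Ordinal lL) 1)).
  by apply: leq_sum => i _; case: (_ == _).
rewrite sum1_card cardC1 card_ord; lia.
Qed.

Definition arrives s i q l : bool :=
  [&& status s l != 0, on_line (nth_line l) (nth_point q),
      (distance s l <= (nth_point q).1)%R
    & ((nth_point i).1 < (nth_point q).1)%R].

Lemma collect_targetP s i q : holds_input s -> nmem s SRC 0 0 = i ->
  nmem s TGT 0 0 = q ->
  let s' := den (CFor LN collect_body) s in
  forall i' j, nmem s' ADJ i' j =
    if [&& i' == i, j == q & has (arrives s i q) (iota 0 n)] then 1
    else nmem s ADJ i' j.
Proof.
move=> hs si sq s'.
apply: (@den_for _ (fun k s1 => forall i' j, nmem s1 ADJ i' j =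
    if [&& i' == i, j == q & has (arrives s i q) (iota 0 k)] then 1
    else nmem s ADJ i' j)) => //; first by case: hs.
  by move=> i' j; rewrite !andbF.
move=> k s1 kn s1k _ fr Ik i' j.
have h1 : holds_input s1 by apply: holds_input_frame fr hs.
have s1i : nmem s1 SRC 0 0 = i by have [-> ] := fr.
have s1q : nmem s1 TGT 0 0 = q by have [-> ] := fr.
have test : beval s1 arrive_test = arrives s i q k.
  rewrite /arrive_test 2!beval_and beval_on_line // beval_and beval_ltR.
  rewrite beval_not beval_eqN beval_leR !reval_coord0 //= s1q s1i s1k /arrives.
  by have [-> // _] := fr; have [_ -> //] := fr.
rewrite /collect_body den_if test -[k.+1]addn1 iotaD has_cat add0n /= orbF.
case: ifP => _ /=; rewrite /upd /= ?s1i ?s1q ?Ik ?orbF //.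
by rewrite orbT andbT; case: (i' == i); case: (j == q) => //=; rewrite Ik.
Qed.

Lemma collectP s i : holds_input s -> nmem s SRC 0 0 = i ->
  let s' := den (CFor TGT (CFor LN collect_body)) s in
  forall i' j, nmem s' ADJ i' j =
    if [&& i' == i, j < n & has (arrives s i j) (iota 0 n)] then 1
    else nmem s ADJ i' j.
Proof.
move=> hs si s'.
apply: (@den_for _ (fun q s1 => forall i' j, nmem s1 ADJ i' j =
    if [&& i' == i, j < q & has (arrives s i j) (iota 0 n)] then 1
    else nmem s ADJ i' j)) => //; first by case: hs.
  by move=> i' j; rewrite ltn0 andbF.
move=> q s1 qn s1q _ fr Iq i' j.
have h1 : holds_input s1 by apply: holds_input_frame fr hs.
have s1i : nmem s1 SRC 0 0 = i by have [-> ] := fr.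
have same : arrives s1 i q =1 arrives s i q.
  by move=> l; rewrite /arrives; have [-> // _] := fr; have [_ -> //] := fr.
have := collect_targetP h1 s1i s1q i' j; cbv zeta.
rewrite (eq_has same) => E.
transitivity (nmem (den (CFor LN collect_body) s1) ADJ i' j); first by [].
rewrite E Iq ltnS [j <= q]leq_eqVlt.
by have [->|jq] := eqVneq j q; rewrite ?andbF //= ltnn andbF.
Qed.

Definition reachable i q : Prop :=
  ((nth_point i).1 < (nth_point q).1)%R /\ reach L (nth_point i) (nth_point q).

Lemma source_bodyP s i : holds_input s -> nmem s SRC 0 0 = i ->
  (forall q, nmem s ADJ i q = 0) ->
  let s' := den source_body s in
  (forall i' j, i' != i -> nmem s' ADJ i' j = nmem s ADJ i' j) /\
  forall q, q < n -> nmem s' ADJ i q = 1 <-> reachable i q.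
Proof.
move=> hs si zero s'.
have fr1 := den_frame (CFor LN init_body) s.
have [D1 le1] := init_linesP hs si.
rewrite /s' /source_body den_seq; set s1 := den _ s in fr1 D1 le1 *.
have h1 : holds_input s1 by apply: holds_input_frame fr1 hs.
have fr2 := den_frame (CFor RND settle) s1.
rewrite den_seq; set s2 := den (CFor RND settle) s1 in fr2 *.
have h2 : holds_input s2 by apply: holds_input_frame fr2 h1.
have s2i : nmem s2 SRC 0 0 = i by have [-> // _] := fr2; have [-> // _] := fr1.
have [D2 le2 pr2] : [/\ dijkstra L (nth_point i) (status s2) (distance s2),
    forall l, l < n -> status s2 l <= 2 & progress n s2].
  apply: (@den_for _ (fun r s0 => [/\ dijkstra L (nth_point i) (status s0) (distance s0),
    forall l, l < n -> status s0 l <= 2 & progress r s0])) => //.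
  - by case: h1.
  - by split=> //; right.
  move=> r s0 rn _ _ fr [D0 le0 pr0].
  have h0 : holds_input s0 by apply: holds_input_frame fr h1.
  exact: (settleP h0 D0 le0 pr0).
have adj2 i' j : nmem s2 ADJ i' j = nmem s ADJ i' j.
  by have [-> // _] := fr2; have [-> // _] := fr1.
have collect := collectP h2 s2i; cbv zeta in collect.
split=> [i' j ne|q qn]; first by rewrite collect (negbTE ne) /= adj2.
rewrite collect eqxx qn adj2 zero /=.
have on_some : exists2 l, l < n & on_line (nth_line l) (nth_point q).
  have [l] := points_on_lines PL (Ordinal qn).
  by rewrite !(tnth_nth (0, 0)%R) => lq; exists l.
have R2 := dijkstra_reach PL D2 (settled_final le2 pr2) on_some.
split.
  case: hasP => // [[l]]; rewrite mem_iota add0n => /andP[_ lL].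
  case/and4P=> sl lq dl lt _; split=> //; apply/R2; by exists l.
move=> [lt /R2[l [lL sl lq dl]]].
case: hasP => // [[]]; exists l; first by rewrite mem_iota.
by rewrite /arrives sl lq dl lt.
Qed.

Lemma reach_cmdP s : holds_input s -> (forall i q, nmem s ADJ i q = 0) ->
  forall i q, i < n -> q < n -> nmem (den reach_cmd s) ADJ i q = 1 <-> reachable i q.
Proof.
move=> hs zero.
(* The invariant also records that later rows are still zero, because the program only ever writes 1
   there. *)
suff [] : (forall i q, i < n -> q < n ->
    nmem (den reach_cmd s) ADJ i q = 1 <-> reachable i q) /\
  forall i q, n <= i -> nmem (den reach_cmd s) ADJ i q = 0 by [].
apply: (@den_for _ (fun k s1 => (forall i q, i < k -> q < n ->
    nmem s1 ADJ i q = 1 <-> reachable i q) /\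
  forall i q, k <= i -> nmem s1 ADJ i q = 0)) => //; first by case: hs.
  by split=> [|i q _] //; apply: zero.
move=> k s1 kn s1k _ fr [done todo].
have h1 : holds_input s1 by apply: holds_input_frame fr hs.
have [keep new] := source_bodyP h1 s1k (fun q => todo k q (leqnn k)).
set s2 := den source_body s1 in keep new *.
split=> i q; last first.
  move=> ki; transitivity (nmem s2 ADJ i q); first by [].
  by rewrite keep ?gtn_eqF // todo // ltnW.
rewrite ltnS leq_eqVlt => /orP[/eqP->|ik] qn; first exact: new.
suff -> : nmem (tick SRC s2) ADJ i q = nmem s1 ADJ i q by apply: done.
by rewrite -keep // ltn_eqF.
Qed.
End ReachProgram.

(** * The auction and output programs *)

Definition any : bexp := BLeN (NConst 0) (NConst 0).

(** A positive price shows that v is owned; the owner is freed before the [MATE] cell that names it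
    is overwritten. *)
Definition trade : cmd :=
  CSeq (CIf (ltN (NConst 0) (cell LAB (var VV)))
            (set_cell STAT (cell MATE (var VV)) (NConst 0)) CSkip)
 (CSeq (set_cell MATE (var VV) (var UU))
 (CSeq (set_cell STAT (var UU) (NConst 1))
       (set_cell LAB (var VV) (NSucc (cell LAB (var VV)))))).

(** The test [any] lets the first scan pick an arbitrary active vertex. The bidder retires if it has
    no successor or if the cheapest costs more than n. *)
Definition bid : cmd :=
  CSeq (scan SCAN UU (eqN (cell STAT (var SCAN)) (NConst 0)) any)
 (CIf (ltN (var UU) (var SIZE))
   (CSeq (scan SCAN VV (eqN (NGet ADJ (var UU) (var SCAN)) (NConst 1))
                       (BLeN (cell LAB (var SCAN)) (cell LAB (var VV))))
    (CIf (BAnd (ltN (var VV) (var SIZE)) (BLeN (cell LAB (var VV)) (var SIZE)))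
         trade (set_cell STAT (var UU) (NConst 2))))
   CSkip).

(* Each bid increases the potential, which is at most n (n + 2): four bids in
   each of the n^2 rounds leave no active point. *)
Definition auction_cmd : cmd :=
  CFor ROW (CFor COL (CSeq bid (CSeq bid (CSeq bid bid)))).

(** [LEV] climbs while the price one above it is attained, and stays at the first gap. *)
Definition level_body : cmd :=
  CSeq (scan SCAN VV (eqN (cell LAB (var SCAN)) (NSucc (var LEV))) any)
       (CIf (ltN (var VV) (var SIZE)) (set_var LEV (NSucc (var LEV))) CSkip).

Definition level_cmd : cmd :=
  CSeq (set_var LEV (NConst 0)) (CFor ROW level_body).

Definition select_body : cmd :=
  CIf (BLeN (cell LAB (var ROW)) (var LEV))
    (set_cell OUT (var ROW) (NConst 1)) (set_cell OUT (var ROW) (NConst 0)).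

Definition discard_body : cmd :=
  CIf (BAnd (ltN (NConst 0) (cell LAB (var ROW)))
            (BLeN (cell LAB (var ROW)) (var LEV)))
    (set_cell OUT (cell MATE (var ROW)) (NConst 0)) CSkip.

Definition output_cmd : cmd := CSeq (CFor ROW select_body) (CFor ROW discard_body).

Definition main_cmd : cmd :=
  CSeq reach_cmd (CSeq auction_cmd (CSeq level_cmd output_cmd)).

(** * Correctness of the auction and output programs *)

Section AuctionProgram.
Variables (R : realType) (n : nat) (adj : rel nat).
Implicit Type s : state R.

Local Notation label s := (fun v => nmem s LAB v 0).
Local Notation mate s := (fun v => nmem s MATE v 0).
Local Notation stat s := (fun u => nmem s STAT u 0).

Record auction_state r s : Prop := {
  auction_size : nmem s SIZE 0 0 = n;
  auction_adj : forall i j, (nmem s ADJ i j == 1) = adj i j;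
  auction_inv : auction n adj (label s) (mate s) (stat s);
  auction_progress : (forall u, u < n -> stat s u != 0) \/
                     r <= potential n (label s) (stat s)
}.

Lemma tradeP s : 
  let s' := den trade s in
  let u := nmem s UU 0 0 in let v := nmem s VV 0 0 in
  [/\ forall i, label s' i = label s i + (i == v),
      forall i, mate s' i = if i == v then u else mate s i
    & forall i, stat s' i = if i == u then 1
        else if (0 < label s v) && (i == mate s v) then 0 else stat s i].
Proof.
cbv zeta; rewrite /trade den_seq den_if beval_ltN [neval _ _]/= [neval _ (cell _ _)]/=.
case: ifP => lv /=; split=> i; rewrite /upd /= ?andbT //=; case: eqP => //= [->|];
  by rewrite ?addn1 ?addn0.
Qed.

Lemma bidP s r : auction_state r s -> auction_state r.+1 (den bid s).
Proof.
move=> [sn sadj A pr].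
have [|||||//|s1 [s1E fr1] res1] := @scanP _ (fun u => stat s u == 0)
  (fun _ _ => true) SCAN UU (eqN (cell STAT (var SCAN)) (NConst 0)) any s n => //.
  by move=> s2 [f2 _] _; rewrite beval_eqN /= f2.
have s1n : nmem s1 SIZE 0 0 = n by have [-> ] := fr1.
have [f1 _] := fr1.
have same1 i : i < n -> [/\ label s1 i = label s i, mate s1 i = mate s i
    & stat s1 i = stat s i] by rewrite !f1.
have [A1 p1] := auction_ext same1 A.
rewrite /bid den_seq s1E den_if beval_ltN [neval s1 (var SIZE)]/= s1n.
rewrite [neval _ _]/=; case: res1 => [[-> none]|[un /eqP stu _]].
  rewrite ltnn; split=> //; first by move=> i j; rewrite f1.
  by left => u un; rewrite f1 // none.
have {}pr : r <= potential n (label s) (stat s).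
  by case: pr => // /(_ _ un); rewrite stu.
rewrite un; set u := nmem s1 UU 0 0 in un stu *; rewrite den_seq.
have [|||||//|s2 [s2E fr2] res2] := @scanP _ (adj u)
  (fun v w => label s v <= label s w) SCAN VV
  (eqN (NGet ADJ (var UU) (var SCAN)) (NConst 1))
  (BLeN (cell LAB (var SCAN)) (cell LAB (var VV))) s1 n => //.
- by move=> s3 [f3 _] _; rewrite beval_eqN /= (f3 ADJ) // (f3 UU) // f1.
- by move=> s3 [f3 _] _ _; rewrite /= !(f3 LAB) // !f1.
- by move=> v w; apply: leq_total.
- by move=> w v x; apply: leq_trans.
rewrite s2E; have [f2 _] := fr2.
have s2n : nmem s2 SIZE 0 0 = n by rewrite f2.
have s2u : nmem s2 UU 0 0 = u by rewrite f2.
have same2 i : i < n -> [/\ label s2 i = label s i, mate s2 i = mate s i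
    & stat s2 i = stat s i] by rewrite !f2 // !f1.
have [A2 p2] := auction_ext same2 A.
have adj2 i j : (nmem s2 ADJ i j == 1) = adj i j by rewrite f2 // f1.
rewrite den_if beval_and beval_ltN [neval s2 (var SIZE)]/= s2n.
rewrite [beval _ _]/= [neval _ _]/=; set v := nmem s2 VV 0 0 in res2 *.
rewrite s2n; have [/andP[vn lv]|retire] := boolP ((v < n) && (label s2 v <= n)).
  have [uv vmin] : adj u v /\ forall w, w < n -> adj u w -> label s v <= label s w.
    by case: res2 => [[vE _]|[_ uv vmin]] //; rewrite vE ltnn in vn.
  have [labE mateE statE] := tradeP s2; cbv zeta in labE, mateE, statE.
  rewrite s2u -/v in labE mateE statE.
  set s3 := den trade s2 in labE mateE statE *.
  have [|||||A3 p3] := @auction_match n adj (label s2) (mate s2) (stat s2)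
      (label s3) (mate s3) (stat s3) u v A2 un _ vn uv _ lv.
  - by rewrite f2 // f1.
  - by move=> w wn uw; rewrite !(f2 LAB) // !f1 // vmin.
  - by move=> i _; apply: labE.
  - by move=> i _; apply: mateE.
  - by move=> i _; apply: statE.
  have f3 := den_nmem (c := trade) s2.
  split=> //; [by rewrite /s3 f3 | by move=> i j; rewrite /s3 f3 |].
  by right; rewrite p3 p2.
set s3 := den _ s2.
have [|||A3 p3] := @auction_retire n adj (label s2) (mate s2) (stat s2) (stat s3)
    u A2 un.
- by rewrite f2 // f1.
(* Either u has no successor at all, or its cheapest one is priced above n. *)
- move=> w wn uw; case: res2 => [[_ /(_ w wn)]|[vn _ vmin]]; first by rewrite uw.
  move: retire; rewrite vn /= -ltnNge !(f2 LAB) // !f1 // => lv.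
  exact: leq_trans lv (vmin w wn uw).
- by move=> i _; rewrite /s3 /= /upd /= s2u andbT.
by split=> //; right; rewrite p3 p2.
Qed.

Lemma auction_cmdP s : nmem s SIZE 0 0 = n ->
  (forall i j, (nmem s ADJ i j == 1) = adj i j) ->
  (forall i, label s i = 0) -> (forall i, stat s i = 0) ->
  let s' := den auction_cmd s in
  auction n adj (label s') (mate s') (stat s') /\
  forall u, u < n -> stat s' u != 0.
Proof.
move=> sn sadj l0 s0 s'.
have S0 : auction_state 0 s.
  by split=> //; [apply: auction_init | right].
have seq4 c s1 : den (CSeq c (CSeq c (CSeq c c))) s1 =
    den c (den c (den c (den c s1))) by [].
have tick_row r s1 : auction_state r s1 -> auction_state r (tick ROW s1).
  by case; split.
have tick_col r s1 : auction_state r s1 -> auction_state r (tick COL s1).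
  by case; split.
have [_ _ A pr] : auction_state (4 * n * n) s'.
  apply: (@den_for _ (fun k => auction_state (4 * n * k))) => //.
    by rewrite muln0; case: S0.
  move=> k s1 kn _ s1n _ S1.
  suff: auction_state (4 * n * k + 4 * n)
          (den (CFor COL (CSeq bid (CSeq bid (CSeq bid bid)))) s1).
    by rewrite addnC -mulnS; apply: tick_row.
  apply: (@den_for _ (fun j => auction_state (4 * n * k + 4 * j))) => //.
    by rewrite muln0 addn0; case: S1.
  move=> j s2 jn _ s2n _ S2.
  have -> : 4 * n * k + 4 * j.+1 = (4 * n * k + 4 * j).+4 by lia.
  rewrite seq4; apply: tick_col; do 4 apply: bidP; exact: S2.
split=> // u un; case: pr => [active|full]; first exact: active.
(* As u < n makes n positive, 4 n ^ 2 exceeds the potential bound n (n + 2). *)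
have := leq_trans full (potential_bound A); nia.
Qed.

Lemma level_cmdP s : nmem s SIZE 0 0 = n ->
  let s' := den level_cmd s in
  nmem s' LEV 0 0 <= n /\
  forall v, v < n -> label s v != (nmem s' LEV 0 0).+1.
Proof.
move=> sn; rewrite /level_cmd den_seq; set s1 := den (set_var _ _) s; cbv zeta.
set s' := den _ s1.
(* All prices from 1 to [LEV] are attained, and unless a gap has been met [LEV] equals the number of
   rounds. *)
have [surj gap] : (forall j, 0 < j <= nmem s' LEV 0 0 ->
      exists2 v, v < n & label s v = j) /\
    ((forall v, v < n -> label s v != (nmem s' LEV 0 0).+1) \/
      nmem s' LEV 0 0 = n).
  apply: (@den_for _ (fun k s2 => (forall j, 0 < j <= nmem s2 LEV 0 0 ->
      exists2 v, v < n & label s v = j) /\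
    ((forall v, v < n -> label s v != (nmem s2 LEV 0 0).+1) \/
      nmem s2 LEV 0 0 = k))) => //.
    by split=> [j|]; [rewrite /= /upd /=; case: j | right].
  move=> k s2 kn _ s2n [f2 _] [surj gap].
  have lab2 v : label s2 v = label s v by rewrite f2.
  have [||||//|//|s3 [s3E [f3 _]] res3] := @scanP _
    (fun v => label s v == (nmem s2 LEV 0 0).+1) (fun _ _ => true) SCAN VV
    (eqN (cell LAB (var SCAN)) (NSucc (var LEV))) any s2 n => //.
    by move=> s4 [f4 _] _; rewrite beval_eqN /= (f4 LAB) // (f4 LEV) // lab2.
  have lev3 : nmem s3 LEV 0 0 = nmem s2 LEV 0 0 by rewrite f3.
  rewrite /level_body den_seq s3E den_if beval_ltN [neval s3 (var SIZE)]/= f3 //.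
  rewrite s2n [neval _ _]/=; case: res3 => [[-> none]|[vn /eqP labv _]].
    by rewrite ltnn /= /upd /= lev3; split=> //; left.
  rewrite vn /= /upd /= lev3; split=> [j|]; last first.
    by case: gap => [/(_ _ vn)|->]; [rewrite labv eqxx | right].
  rewrite [j <= _]leq_eqVlt andb_orr => /orP[/andP[_ /eqP->]|]; last exact: surj.
  by exists (nmem s3 VV 0 0).
have Kn := surjective_labels surj; split=> // v vn.
case: gap => [gap|Kn']; first exact: gap.
(* If [LEV] ends at n, an attained price n + 1 would give n + 1 distinct prices to n vertices. *)
apply/eqP => lv; suff: n.+1 <= n by rewrite ltnn.
apply: (surjective_labels (label := label s)) => j.
rewrite [j <= _]leq_eqVlt andb_orr -{2}Kn' => /orP[/andP[_ /eqP->]|]; last exact: surj.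
by exists v; rewrite // lv Kn'.
Qed.

(** Selection is complete before any discarding, because a discard writes to the row of a mate,
    which can be any row. *)
Lemma output_cmdP s : nmem s SIZE 0 0 = n ->
  output n (den output_cmd s) =
  auction_output n (label s) (mate s) (nmem s LEV 0 0).
Proof.
move=> sn; set k := nmem s LEV 0 0.
rewrite /output_cmd den_seq; set s1 := den (CFor ROW select_body) s.
have fr1 : frame (nat_writes (CFor ROW select_body)) [::] s s1.
  exact: den_frame (CFor ROW select_body) s.
have [f1 _] := fr1.
have sel : forall i, i < n -> nmem s1 OUT i 0 = (label s i <= k).
  apply: (@den_for _ (fun r s2 => forall i, i < r ->
      nmem s2 OUT i 0 = (label s i <= k))) => //.
  move=> r s2 rn s2r _ [f2 _] IH i.
  rewrite ltnS leq_eqVlt /select_body /= !(f2 LAB) // (f2 LEV) // s2r -/k.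
  by have [->|ir] := eqVneq i r => /= [_|/IH <-];
    case: ifP => _ /=; rewrite /upd /= ?eqxx ?(negbTE ir).
pose used i v := (0 < label s v <= k) && (mate s v == i).
have dis : forall i, i < n -> nmem (den (CFor ROW discard_body) s1) OUT i 0 =
    (label s i <= k) && ~~ has (used i) (iota 0 n).
  apply: (@den_for _ (fun r s2 => forall i, i < n -> nmem s2 OUT i 0 =
    (label s i <= k) && ~~ has (used i) (iota 0 r))) => //.
  - by rewrite f1.
  - by move=> i lin; rewrite /= andbT; apply: sel.
  move=> r s2 rn s2r _ [f2 _] IH i lin.
  have -> : has (used i) (iota 0 r.+1) = has (used i) (iota 0 r) || used i r.
    by rewrite -[r.+1]addn1 iotaD has_cat /= orbF.
  rewrite /discard_body den_if beval_and beval_ltN /= s2r !(f2 LAB) // (f2 LEV) //.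
  rewrite negb_or andbA.
  rewrite !(f1 LAB) // (f1 LEV) // -/k /used.
  case: ifP => _ /=; rewrite /upd /= ?IH ?andbT //.
  rewrite (f2 MATE) // (f1 MATE) // eq_sym.
  by case: (_ == i); rewrite /= ?andbF ?andbT.
apply/setP => i; rewrite !inE dis //.
have -> : has (used i) (iota 0 n) =
    [exists v : 'I_n, (0 < label s v <= k) && (mate s v == i)].
  apply/hasP/existsP => [[v]|[v uv]].
    by rewrite mem_iota => /andP[_ vn] uv; exists (Ordinal vn).
  by exists (val v) => //; rewrite mem_iota /=.
by case: (_ && _).
Qed.
End AuctionProgram.

(* The program and the constant are chosen before n and the input. *)
Theorem lemma3p14 (R : realType) :
  exists (c : prog) (C : nat),
  forall (n : nat) (P : n.-tuple (point R)) (L : n.-tuple (line R)),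
    point_line_config P L ->
    exists (s : state R) (t : nat),
      exec c (input P L) s t /\
      largest_isolated P L (output n s) /\
      ((0 < n)%N -> (t <= C * n ^ 3)%N).
Proof.
exists (compile main_cmd), (cost main_cmd) => n P L PL.
(* The side conditions hold by computation, and [depth main_cmd] computes to 3, the exponent
   claimed. *)
have [//|//|//|t run time] := @compile_exec R n main_cmd (input P L).
exists (den main_cmd (input P L)), t; split=> //; split=> //.
pose s0 := input P L.
have h0 : holds_input P L s0 by [].
pose s1 := den reach_cmd s0.
pose adj i j := nmem s1 ADJ i j == 1.
have adjP i j : i < n -> j < n -> reflect (reachable P L i j) (adj i j).
  move=> lin jn; apply: (iffP eqP);
    by have [] := reach_cmdP PL h0 (fun _ _ => erefl) lin jn.
have f1 a : a \notin nat_writes reach_cmd -> forall i j, nmem s1 a i j = nmem s0 a i j.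
  exact: den_nmem.
have s1n : nmem s1 SIZE 0 0 = n by rewrite f1.
have [|||A active0] := auction_cmdP (adj := adj) s1n.
- by [].
- by move=> i; rewrite f1.
- by move=> i; rewrite f1.
set s2 := den auction_cmd s1 in A active0.
have s2n : nmem s2 SIZE 0 0 = n by rewrite den_nmem.
have [kn gap] := level_cmdP s2n; set s3 := den level_cmd s2 in kn gap.
have s3n : nmem s3 SIZE 0 0 = n by rewrite den_nmem.
have f3 a : a \notin nat_writes level_cmd -> forall i j, nmem s3 a i j = nmem s2 a i j.
  exact: den_nmem.
have same3 i : i < n -> [/\ nmem s3 LAB i 0 = nmem s2 LAB i 0,
    nmem s3 MATE i 0 = nmem s2 MATE i 0 & nmem s3 STAT i 0 = nmem s2 STAT i 0].
  by rewrite !f3.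
have [A3 _] := auction_ext same3 A.
(* Isolated sets are the antichains of [adj]: reaching a different point means moving strictly
   right, and strictness rules out equal indices. *)
have isoP (B : {set 'I_n}) :
    isolated P L B <-> {in B &, forall i j : 'I_n, ~~ adj i j}.
  split=> [iso i j iB jB|anti i j iB jB ij].
    apply/adjP => // -[lt ij]; have [E|ne] := eqVneq i j.
      by move: lt; rewrite E ltxx.
    by case: (iso i j iB jB ne); rewrite !(tnth_nth (0, 0)%R).
  move=> pij; case/adjP: (anti i j iB jB) => //.
  split; last by move: pij; rewrite !(tnth_nth (0, 0)%R).
  rewrite /nth_point -!tnth_nth; apply: reach_ltx pij _.
  by apply: contra ij => /eqP/(points_distinct PL)/eqP.
have -> : output n (den main_cmd s0) =
    auction_output n (fun v => nmem s3 LAB v 0) (fun v => nmem s3 MATE v 0)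
      (nmem s3 LEV 0 0) by exact: output_cmdP.
have [| | | | |anti best] := auction_optimal (k := nmem s3 LEV 0 0) _ _ A3.
- move=> i j l lin jn ln_ /adjP[//|//|ltij rij] /adjP[//|//|ltjl rjl].
  apply/adjP => //; split; [exact: lt_trans ltij ltjl | exact: reach_trans rij rjl].
- by move=> i lin; apply/adjP => // -[]; rewrite ltxx.
- by move=> u un; rewrite f3 // active0.
- exact: kn.
- by move=> v vn; rewrite f3 // gap.
by split; [apply/isoP | move=> B /isoP/best].
Qed.
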